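(* Let $C>0$ and an integer $\ell\ge 3$ be fixed, and let $p=p(n)>0$ be any function of $n$. Let $(G_n)$ be a sequence of graphs with $|G_n|=n$ such that $\sup_n t_p(F,G_n)<\infty$ for each $F\in \mathcal{T}\cup\mathcal{F}_\ell\cup\{C_{2\ell-2}\}$, and suppose that $d_{\mathrm{cut}}(G_n,\kappa)\to 0$ for some kernel $\kappa:[0,1]^2\to[0,C]$. Then $t_p(F,G_n)\to s(F,\kappa)$ as $n\to\infty$ for each $F\in\mathcal{F}_\ell$.
   Context: Graphs are finite and simple unless stated otherwise; $|G|$ and $e(G)$ are the numbers of vertices and edges, and $C_m$ is the cycle with $m$ vertices. A sequence $(G_n)$ with $|G_n|=n$, $V(G_n)=\{1,\dots,n\}$, need only be defined for $n$ in an infinite subset of $\mathbb{N}$; limits are along that subset. $\hom(F,G)$ is the number of homomorphisms from $F$ to $G$, and for $|G|=n$, $t_p(F,G)=\hom(F,G)/(p^{e(F)}n^{|F|})$ with $p=p(n)$. $\mathcal{T}$ is the set of (isomorphism classes of) finite trees. For $\ell\ge 2$, $\mathcal{F}_\ell$ is the set of (isomorphism classes of) simple graphs obtained from a finite loopless multigraph by subdividing each edge exactly $\ell-1$ times (so each edge becomes a path of length $\ell$). A kernel is a symmetric measurable function $\kappa:[0,1]^2\to[0,\infty)$. For a graph $F$ with vertex set $\{1,\dots,k\}$, $s(F,\kappa)=\int_{[0,1]^k}\prod_{ij\in E(F)}\kappa(x_i,x_j)\,dx_1\cdots dx_k$. The cut norm of an integrable $W:[0,1]^2\to\mathbb{R}$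 is $\|W\|_{\mathrm{cut}}=\sup_{S,T}\left|\int_{S\times T}W(x,y)\,dx\,dy\right|$, the supremum being over measurable $S,T\subset[0,1]$. For kernels, $d_{\mathrm{cut}}(\kappa_1,\kappa_2)=\inf_\tau\|\kappa_1-\kappa_2^{(\tau)}\|_{\mathrm{cut}}$, where $\tau$ runs over measure-preserving bijections $[0,1]\to[0,1]$ and $\kappa^{(\tau)}(x,y)=\kappa(\tau(x),\tau(y))$. To a graph $G$ with vertex set $\{1,\dots,n\}$ associate the kernel $\kappa_G$ equal to $1/p(n)$ on $((i-1)/n,i/n]\times((j-1)/n,j/n]$ whenever $ij\in E(G)$, and $0$ elsewhere; $d_{\mathrm{cut}}(G,\kappa)$ means $d_{\mathrm{cut}}(\kappa_G,\kappa)$. *)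

(* Defs.v *)
From HB Require Import structures.
From mathcomp Require Import all_boot all_order all_algebra.
From mathcomp Require Import all_classical all_reals all_analysis.

Set Implicit Arguments.
Unset Strict Implicit.
Unset Printing Implicit Defensive.

Import Order.TTheory GRing.Theory Num.Theory.
Import numFieldNormedType.Exports.

Local Open Scope classical_set_scope.
Local Open Scope ring_scope.

(* -------- Graphs -------- *)

Record sgraph (V : finType) := SGraph {
  adj : rel V;
  adj_sym : symmetric adj;
  adj_irr : irreflexive adj
}.

Definition edges (V : finType) (F : sgraph V) : {set {set V}} :=
  [set e : {set V} | [exists x, exists y, adj F x y && (e == [set x; y]%SET)]]%SET.

Definition sgraph_iso (V W : finType) (F : sgraph V) (H : sgraph W) : Prop :=
  exists2 f : V -> W, bijective f & forall x y, adj H (f x) (f y) = adj F x y.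

Definition is_tree (V : finType) (F : sgraph V) : Prop :=
  [/\ (0 < #|V|)%N,
      forall x y : V, connect (adj F) x y &
      forall c : seq V, (2 < size c)%N -> ~~ ucycleb (adj F) c].

Definition cycle_adj m : rel 'I_m :=
  fun i j => (i != j) && ((ordS i == j) || (ordS j == i)).

Lemma cycle_adj_sym m : symmetric (@cycle_adj m).
Proof. by move=> i j; rewrite /cycle_adj eq_sym orbC. Qed.

Lemma cycle_adj_irr m : irreflexive (@cycle_adj m).
Proof. by move=> i; rewrite /cycle_adj eqxx. Qed.

(* This is the cycle C_m for m >= 3. *)
Definition cycle_graph m : sgraph 'I_m :=
  SGraph (@cycle_adj_sym m) (@cycle_adj_irr m).

(* The orientation of the edges is only a way of listing the two ends. *)
Record multigraph := Multigraph {
  mvertex : finType;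
  medge : finType;
  msrc : medge -> mvertex;
  mtgt : medge -> mvertex;
  mloopless : forall e, msrc e != mtgt e
}.

(* The l-1 new vertices on the edge e are the (e, i), i < l-1, and e is
   replaced by the path msrc e, (e, 0), ..., (e, l-2), mtgt e.  This is meant
   for l >= 2: no two old vertices are adjacent. *)
Definition subdiv_vertex (l : nat) (M : multigraph) : finType :=
  (mvertex M + medge M * 'I_l.-1)%type.

Definition subdiv_adj (l : nat) (M : multigraph) : rel (subdiv_vertex l M) :=
  let attached (u : mvertex M) (e : medge M) (i : 'I_l.-1) :=
    ((i == 0 :> nat) && (u == msrc e)) ||
    ((i.+1 == l.-1) && (u == mtgt e)) in
  fun x y => match x, y with
  | inl _, inl _ => false
  | inl u, inr (e, i) => attached u e i
  | inr (e, i), inl u => attached u e i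
  | inr (e, i), inr (e', j) =>
      (e == e') && ((i.+1 == j :> nat) || (j.+1 == i :> nat))
  end.

Lemma subdiv_adj_sym l M : symmetric (@subdiv_adj l M).
Proof. by move=> [u|[e i]] [v|[e' j]] //=; rewrite eq_sym orbC. Qed.

Lemma subdiv_adj_irr l M : irreflexive (@subdiv_adj l M).
Proof. by move=> [u|[e i]] //=; rewrite eqxx orbb gtn_eqF. Qed.

Definition subdivision (l : nat) (M : multigraph) : sgraph (subdiv_vertex l M) :=
  SGraph (@subdiv_adj_sym l M) (@subdiv_adj_irr l M).

Definition in_subdiv_family (l : nat) (V : finType) (F : sgraph V) : Prop :=
  exists M : multigraph, sgraph_iso F (subdivision l M).

Definition hom (V W : finType) (F : sgraph V) (G : sgraph W) : nat :=
  #|[set f : {ffun V -> W} |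
      [forall x, forall y, adj F x y ==> adj G (f x) (f y)]]%SET|.

(* The value p(n) is passed as the scalar p. *)
Definition tp (R : realType) (p : R) (V W : finType)
    (F : sgraph V) (G : sgraph W) : R :=
  (hom F G)%:R / (p ^+ #|edges F| * #|W|%:R ^+ #|V|).

(* -------- Lebesgue measure on [0,1]^k -------- *)

Section cube.
Variable R : realType.

Definition unit_itv : set (measurableTypeR R) := `[0%R, 1%R].

Lemma measurable_unit_itv : measurable unit_itv.
Proof. exact: measurable_itv. Qed.

Definition lebesgue01 : set (measurableTypeR R) -> \bar R :=
  mrestr lebesgue_measure measurable_unit_itv.

HB.instance Definition _ := Measure.on lebesgue01.

Lemma lebesgue01_setT : lebesgue01 setT = 1%E.
Proof.
by rewrite /lebesgue01 /mrestr setTI lebesgue_measure_itv /= lte_fin ltr01 oppr0 adde0.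
Qed.

HB.instance Definition _ :=
  Measure_isProbability.Build _ _ _ lebesgue01 lebesgue01_setT.

Definition cons_pair n (x : measurableTypeR R * n.-tuple (measurableTypeR R)) :
    n.+1.-tuple (measurableTypeR R) := [tuple of x.1 :: x.2].

Lemma measurable_cons_pair n : measurable_fun setT (@cons_pair n).
Proof. exact: measurable_cons. Qed.

HB.instance Definition _ n :=
  isMeasurableFun.Build _ _ _ _ (@cons_pair n) (@measurable_cons_pair n).

(* Lebesgue measure on R^k restricted to [0,1]^k. *)
Fixpoint lebesgue_cube k : probability (k.-tuple (measurableTypeR R)) R :=
  match k with
  | 0 => \d_[tuple]
  | k.+1 => distribution (lebesgue01 \x lebesgue_cube k)%E (@cons_pair k)
  end.

Definition cube k : set (k.-tuple (measurableTypeR R)) :=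
  [set x | forall i, unit_itv (tnth x i)].

End cube.

(* -------- Kernels -------- *)

(* A kernel is represented by a function on R^2, of which only the values on
   [0,1]^2 matter.  Measurable means Borel measurable. *)
Definition is_kernel (R : realType) (kappa : R -> R -> R) : Prop :=
  [/\ measurable_fun (@unit_itv R `*` @unit_itv R)
        (fun z : measurableTypeR R * measurableTypeR R => kappa z.1 z.2),
      forall x y, unit_itv x -> unit_itv y -> kappa x y = kappa y x &
      forall x y, unit_itv x -> unit_itv y -> 0 <= kappa x y].

Definition kernel_density (R : realType) k (F : sgraph 'I_k)
    (kappa : R -> R -> R) : \bar R :=
  \int[@lebesgue_cube R k]_(x in @cube R k)
    (\prod_(i < k) \prod_(j < k | (i < j)%N && adj F i j)
        kappa (tnth x i) (tnth x j))%:E.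

Definition cut_norm (R : realType) (W : R -> R -> R) : \bar R :=
  ereal_sup
    [set r | exists S T : set (measurableTypeR R),
      [/\ measurable S, measurable T, S `<=` @unit_itv R, T `<=` @unit_itv R &
          r = `| \int[(@lebesgue_measure R \x @lebesgue_measure R)%E]_(z in S `*` T)
                   (W z.1 z.2)%:E |%E ]].

Definition mpreserving_bij01 (R : realType) (tau : R -> R) : Prop :=
  [/\ set_bij (@unit_itv R) (@unit_itv R) tau,
      measurable_fun (@unit_itv R)
        (tau : measurableTypeR R -> measurableTypeR R) &
      forall A : set (measurableTypeR R), measurable A -> A `<=` @unit_itv R ->
        lebesgue_measure (@unit_itv R `&` tau @^-1` A) = lebesgue_measure A].

Definition d_cut (R : realType) (kappa1 kappa2 : R -> R -> R) : \bar R :=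
  ereal_inf
    [set cut_norm (fun x y => kappa1 x y - kappa2 (tau x) (tau y)) |
      tau in [set tau | mpreserving_bij01 tau]].

(* Vertices are numbered from 0, so that the vertex i owns ]i/n, (i+1)/n]. *)
Definition graph_kernel (R : realType) (p : R) n (G : sgraph 'I_n) : R -> R -> R :=
  fun x y =>
    if [exists i : 'I_n, exists j : 'I_n,
         [&& adj G i j, (i%:R / n%:R < x <= i.+1%:R / n%:R)
           & (j%:R / n%:R < y <= j.+1%:R / n%:R)]]
    then p^-1 else 0.

(* Main.v *)
Require Import Defs.
From HB Require Import structures.
From mathcomp Require Import all_boot all_order all_algebra.
From mathcomp Require Import all_classical all_reals all_analysis.
From mathcomp Require Import measurable_realfun ring lra zify.

Import Order.TTheory GRing.Theory Num.Theory.
Import numFieldNormedType.Exports.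

(** Let A be the adjacency matrix of G_n and W = A / (p n), so that products of
  W are compositions of kernels with respect to the uniform measure on the
  vertices.  Let K be the matrix of the averages of a rearrangement of kappa
  over the n^2 cells, divided by n, and D = W - K.  Unless named otherwise, norms are
  Hilbert-Schmidt norms (sums of squares of entries), which are the L^2 norms of
  the corresponding kernels.

  If F arises from a multigraph M by replacing each edge by a path of length l,
  then t_p(F, G_n) is the mean over the maps g from V(M) to the vertices of the
  product over the edges st of M of n (W^l)(g s, g t): only W^l matters.  When M
  consists of q parallel edges, the boundedness hypothesis says that the
  L^q norm of the kernel W^l is bounded; by Cauchy-Schwarz and telescoping over
  the edges of M, it is thus enough to show that W^l - K^l tends to 0 in norm
  ([small_dev_pow], [small_density]).

  Closeness in the cut norm makes the bilinear form of D small on bounded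
  functions.  Truncation extends this to functions with enough moments, the
  error being controlled by the moments of the degrees, that is, by the density
  of a star ([truncated_form]).  The rows of W^l and the columns of W K and K K
  have such moments, so W^l D W^l and D K tend to 0.  The density of the cycle
  of length 2 l - 2 is the squared norm of W^(l-1); hence that norm is bounded,
  and so is the operator norm of W.

  As W is symmetric, the squared norm of W^j Y is log-convex in j.  Since it is
  bounded at j = 0, its smallness for j = l carries over to j = 1
  ([small_lower]).  Applied on both sides to W^l D W^l, this shows that
  W D W^(l-1) tends to 0, and with D K so does D^2 W^(l-1).  By Cauchy-Schwarz
  D W^(l-1) tends to 0 ([small_WD]): this is where the bound on W^(l-1), rather
  than on W^l, is used.  Finally W^l - K^l is the sum of D W^(l-1) and of terms
  that contain the product K D.

  It remains to compare the density of F in K with its density in kappa.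
  Averaging over cells is self-adjoint and does not change the step kernel of
  G_n, so the average stays close to the rearranged kappa in the cut norm
  ([form_average_close]), and both are bounded: the classical counting lemma,
  which replaces one edge at a time, applies ([counting_lemma]). *)

Set Implicit Arguments.
Unset Strict Implicit.
Unset Printing Implicit Defensive.

Local Open Scope ring_scope.

(** * Hilbert-Schmidt norms and elementary inequalities *)

Section HilbertSchmidt.
Variable R : realFieldType.

(** The defect is half the sum of the squares [(a i * b j - a j * b i) ^+ 2]. *)
Lemma cauchy_schwarz (I : finType) (a b : I -> R) :
  (\sum_i a i * b i) ^+ 2 <= (\sum_i a i ^+ 2) * (\sum_i b i ^+ 2).
Proof.
have H : 0 <= \sum_i \sum_j (a i * b j - a j * b i) ^+ 2.
  by do 2 (apply: sumr_ge0 => ? _); apply: sqr_ge0.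
suff E : \sum_i \sum_j (a i * b j - a j * b i) ^+ 2 =
  ((\sum_i a i ^+ 2) * (\sum_i b i ^+ 2) - (\sum_i a i * b i) ^+ 2) *+ 2.
  by move: H; rewrite E pmulrn_lge0 // subr_ge0.
have -> : \sum_i \sum_j (a i * b j - a j * b i) ^+ 2 =
    \sum_i \sum_j (a i ^+ 2 * b j ^+ 2) + \sum_i \sum_j (b i ^+ 2 * a j ^+ 2)
    - (\sum_i \sum_j (a i * b i) * (a j * b j)) *+ 2.
  rewrite -sumrMnl -sumrN -!big_split /=; apply: eq_bigr => i _.
  by rewrite -sumrMnl -sumrN -!big_split /=; apply: eq_bigr => j _; ring.
have dist (u v : I -> R) : \sum_i \sum_j u i * v j = (\sum_i u i) * (\sum_i v i).
  by rewrite mulr_suml; apply: eq_bigr => i _; rewrite mulr_sumr.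
by rewrite !dist; ring.
Qed.

Lemma sum_sqr_le (I : finType) (a : I -> R) :
  (\sum_i a i) ^+ 2 <= #|I|%:R * \sum_i a i ^+ 2.
Proof.
have := cauchy_schwarz (fun=> 1) a.
under eq_bigr do rewrite mul1r.
by under [X in _ <= X * _ -> _]eq_bigr do rewrite expr1n; rewrite sumr_const.
Qed.

Definition mxdot m n (X Y : 'M[R]_(m, n)) := \sum_i \sum_j X i j * Y i j.
Definition hs m n (X : 'M[R]_(m, n)) := \sum_i \sum_j X i j ^+ 2.

Lemma hs_ge0 m n (X : 'M[R]_(m, n)) : 0 <= hs X.
Proof. by do 2 (apply: sumr_ge0 => ? _); apply: sqr_ge0. Qed.

Lemma hs_dot m n (X : 'M[R]_(m, n)) : hs X = mxdot X X.
Proof. by apply: eq_bigr => i _; apply: eq_bigr => j _; rewrite expr2. Qed.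

Lemma hs_tr m n (X : 'M[R]_(m, n)) : hs X^T = hs X.
Proof.
rewrite /hs exchange_big /=; apply: eq_bigr => i _; apply: eq_bigr => j _.
by rewrite mxE.
Qed.

Lemma mxdot_tr m n (X Y : 'M[R]_(m, n)) : mxdot X Y = \tr (X^T *m Y).
Proof.
rewrite /mxdot exchange_big /mxtrace; apply: eq_bigr => j _ /=.
by rewrite mxE; apply: eq_bigr => i _; rewrite mxE.
Qed.

Lemma mxdot_mulmxl m n (A : 'M[R]_m) (X Y : 'M[R]_(m, n)) :
  A^T = A -> mxdot (A *m X) Y = mxdot X (A *m Y).
Proof. by move=> sA; rewrite !mxdot_tr trmx_mul sA mulmxA. Qed.

Lemma mxdot_le m n (X Y : 'M[R]_(m, n)) : mxdot X Y ^+ 2 <= hs X * hs Y.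
Proof.
have := cauchy_schwarz (fun u : 'I_m * 'I_n => X u.1 u.2) (fun u => Y u.1 u.2).
rewrite -(pair_bigA _ (fun i j => X i j * Y i j)) /=.
by rewrite -(pair_bigA _ (fun i j => X i j ^+ 2)) -(pair_bigA _ (fun i j => Y i j ^+ 2)).
Qed.

Lemma hs_mulmx m n q (X : 'M[R]_(m, n)) (Y : 'M[R]_(n, q)) :
  hs (X *m Y) <= hs X * hs Y.
Proof.
rewrite /hs mulr_suml; apply: ler_sum => i _.
rewrite [X in _ <= _ * X]exchange_big /= mulr_sumr.
by apply: ler_sum => j _; rewrite mxE; exact: (cauchy_schwarz (X i) (Y^~ j)).
Qed.

Lemma hs_add m n (X Y : 'M[R]_(m, n)) : hs (X + Y) <= 2 * hs X + 2 * hs Y.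
Proof.
rewrite /hs !mulr_sumr -big_split; apply: ler_sum => i _ /=.
rewrite !mulr_sumr -big_split; apply: ler_sum => j _ /=; rewrite !mxE.
by rewrite -subr_ge0 (_ : _ - _ = (X i j - Y i j) ^+ 2) ?sqr_ge0 //; ring.
Qed.

Lemma hsN m n (X : 'M[R]_(m, n)) : hs (- X) = hs X.
Proof. by do 2 (apply: eq_bigr => ? _); rewrite mxE sqrrN. Qed.

Lemma hs_sub m n (X Y : 'M[R]_(m, n)) : hs (X - Y) <= 2 * hs X + 2 * hs Y.
Proof. by rewrite -(hsN Y); exact: hs_add. Qed.

(** The ratios of consecutive terms are nondecreasing, and s 1 / s 0 is the
  first of the m + 1 ratios whose product is s (m + 1) / s 0. *)
Lemma logconvex_endpoint (s : nat -> R) m :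
  (forall j, 0 <= s j) -> (forall j, s j.+1 ^+ 2 <= s j * s j.+2) ->
  s 1 ^+ m.+1 <= s 0 ^+ m * s m.+1.
Proof.
move=> s0 cvx.
have step j : s 1 * s j <= s 0 * s j.+1.
  elim: j => [|j IH]; first by rewrite mulrC.
  have [->|/negPf sj] := eqVneq (s j.+1) 0; first by rewrite mulr0 mulr_ge0.
  have sj_gt0 : 0 < s j.+1 by rewrite lt0r sj s0.
  rewrite -(ler_pM2r sj_gt0) -mulrA -expr2.
  apply: (le_trans (ler_wpM2l (s0 1) (cvx j))).
  rewrite mulrA; apply: (le_trans (ler_wpM2r (s0 _) IH)).
  by rewrite -!mulrA [s j.+1 * _]mulrC.
elim: m => [|m IH]; first by rewrite expr0 mul1r expr1.
rewrite exprS; apply: (le_trans (ler_wpM2l (s0 1) IH)).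
rewrite mulrCA exprSr -mulrA.
by apply: ler_wpM2l; [rewrite exprn_ge0|exact: step].
Qed.

(** For a symmetric W the numbers [hs (W ^+ j *m Y)] are the even moments of a
  positive measure on the spectrum of W, hence log-convex in j. *)
Lemma hs_pow_endpoint n q (W : 'M[R]_n) (Y : 'M[R]_(n, q)) m : W^T = W ->
  hs (W *m Y) ^+ m.+1 <= hs Y ^+ m * hs (W ^+ m.+1 *m Y).
Proof.
move=> sW; pose s j := hs (W ^+ j *m Y).
have := @logconvex_endpoint s m; rewrite /s expr0 expr1 mul1mx; apply.
  by move=> j; exact: hs_ge0.
move=> j; rewrite [X in X ^+ 2]hs_dot [in X in mxdot X _]exprS -mulmxE -mulmxA.
rewrite mxdot_mulmxl // mulmxA mulmxE -exprS.
exact: mxdot_le.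
Qed.

(** A bound on the norm of one power of a symmetric W bounds its operator norm:
  in the log-convexity inequality the last term is at most
  [hs (W ^+ m.+1) * hs Y]. *)
Lemma hs_pow_bound n q (W : 'M[R]_n) m (Y : 'M[R]_(n, q)) : W^T = W ->
  hs (W *m Y) <= (hs (W ^+ m.+1) + 1) * hs Y.
Proof.
move=> sW; have B0 := hs_ge0 (W ^+ m.+1); have Y0 := hs_ge0 Y.
have B1 : 0 <= hs (W ^+ m.+1) + 1 by rewrite addr_ge0.
rewrite -(@ler_pXn2r _ m.+1) // ?nnegrE ?hs_ge0 ?mulr_ge0 //.
apply: (le_trans (hs_pow_endpoint Y m sW)).
apply: (le_trans (ler_wpM2l (exprn_ge0 m Y0) (hs_mulmx _ _))).
rewrite mulrCA -exprSr exprMn ler_wpM2r ?exprn_ge0 //.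
rewrite [X in _ <= X]exprS -[X in X <= _]mulr1; apply: ler_pM => //; first by rewrite lerDl.
by apply: exprn_ege1; rewrite lerDr.
Qed.

Lemma prod_dist_le (I : Type) (r : seq I) (a b c : I -> R) :
  (forall i, 0 <= a i <= c i) -> (forall i, 0 <= b i <= c i) -> (forall i, 1 <= c i) ->
  `|\prod_(i <- r) a i - \prod_(i <- r) b i| <=
    (\sum_(i <- r) `|a i - b i|) * \prod_(i <- r) c i.
Proof.
move=> ac bc c1; elim: r => [|x r IH]; first by rewrite !big_nil subrr normr0 mul0r.
rewrite !big_cons; set A := \prod_(i <- r) a i in IH *.
set B := \prod_(i <- r) b i in IH *; set P := \prod_(i <- r) c i in IH *.
have /andP[a0 a1] := ac x; have /andP[b0 b1] := bc x; have cx := c1 x.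
have P0 : 0 <= P by apply: prodr_ge0 => i _; exact: le_trans (c1 i).
have A0 : 0 <= A by apply: prodr_ge0 => i _; case/andP: (ac i).
have AP : A <= P by apply: ler_prod => i _; exact: ac.
rewrite (_ : _ - _ = (a x - b x) * A + b x * (A - B)); last by ring.
apply: (le_trans (ler_normD _ _)); rewrite !normrM (ger0_norm A0) (ger0_norm b0).
rewrite [leRHS](_ : _ = `|a x - b x| * (c x * P) + c x * ((\sum_(i <- r) `|a i - b i|) * P)); last by ring.
apply: lerD; last by apply: ler_pM.
by rewrite ler_wpM2l // (le_trans AP) // ler_peMl.
Qed.

(** A product is at most the power of its largest factor; this replaces
  Hoelder's inequality with many functions.  The summand 1 covers the empty
  product. *)
Lemma prod_le_sum_exp (I : finType) (c : I -> R) : (forall i, 0 <= c i) ->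
  \prod_i c i <= 1 + \sum_i c i ^+ #|I|.
Proof.
move=> c0; have pos : 0 <= \sum_i c i ^+ #|I| by apply: sumr_ge0 => i _; rewrite exprn_ge0.
case: (pickP (@predT I)) => [i0 _|I0]; last by rewrite big_pred0 ?lerDl // => i; exact: I0.
pose x := [arg max_(i > i0) c i]%O.
have xP i : c i <= c x.
  by rewrite /x; case: arg_maxP => // j _ /(_ i isT).
apply: (@le_trans _ _ (c x ^+ #|I|)).
  by rewrite -prodr_const; apply: ler_prod => i _; rewrite c0 xP.
rewrite (bigD1 x) //= addrCA lerDl addr_ge0 // sumr_ge0 // => i _.
by rewrite exprn_ge0.
Qed.

Lemma exprD_le (a b : R) k : 0 <= a -> 0 <= b ->
  (a + b) ^+ k <= 2 ^+ k * (a ^+ k + b ^+ k).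
Proof.
move=> a0 b0; wlog ab : a b a0 b0 / a <= b.
  move=> H; case: (leP a b) => [|/ltW] h; first exact: H.
  by rewrite addrC [X in _ * X]addrC; exact: H.
apply: (@le_trans _ _ ((2 * b) ^+ k)).
  by rewrite lerXn2r ?nnegrE ?addr_ge0 ?mulr_ge0 // mulr_natl mulr2n lerD2r.
by rewrite exprMn ler_wpM2l ?exprn_ge0 // lerDr exprn_ge0.
Qed.

Lemma sum_ffun_prod (V : finType) n (G : V -> 'I_n -> R) :
  \sum_(g : {ffun V -> 'I_n}) \prod_v G v (g v) = \prod_v \sum_i G v i.
Proof. by rewrite bigA_distr_bigA. Qed.

(** Two distinct coordinates of a uniformly random function are uniform and
  independent. *)
Lemma sum_ffun_two (V : finType) n (F : 'I_n -> 'I_n -> R) (x y : V) : x != y ->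
  n%:R ^+ 2 * (\sum_(g : {ffun V -> 'I_n}) F (g x) (g y)) =
  n%:R ^+ #|V| * \sum_i \sum_j F i j.
Proof.
move=> xy; pose G i j v (k : 'I_n) : R :=
  if v == x then (k == i)%:R else if v == y then (k == j)%:R else 1.
have FE (g : {ffun V -> 'I_n}) :
    F (g x) (g y) = \sum_i \sum_j F i j * \prod_v G i j v (g v).
  have GE i j : \prod_v G i j v (g v) = (g x == i)%:R * (g y == j)%:R.
    rewrite (bigD1 x) //= (bigD1 y) ?[y == x]eq_sym //= big1.
      by rewrite /G eqxx [y == x]eq_sym (negPf xy) eqxx mulr1.
    by move=> v /andP[/negPf vx /negPf vy]; rewrite /G vx vy.
  rewrite (bigD1 (g x)) //= (bigD1 (g y)) //= GE !eqxx !mulr1 !big1 ?addr0 //.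
    move=> i /negPf ix; rewrite big1 // => j _.
    by rewrite GE [g x == i]eq_sym ix mul0r mulr0.
  by move=> j /negPf jy; rewrite GE [g y == j]eq_sym jy !mulr0.
under eq_bigr do rewrite FE.
rewrite exchange_big /= !mulr_sumr; apply: eq_bigr => i _.
rewrite exchange_big /= !mulr_sumr; apply: eq_bigr => j _.
rewrite -mulr_sumr sum_ffun_prod mulrCA [RHS]mulrC; congr (_ * _).
rewrite -prodr_const (bigD1 x) //= [in RHS](bigD1 x) //=.
have yx : y != x by rewrite eq_sym.
rewrite (bigD1 y) //= [in RHS](bigD1 y) //=.
have delta (k : 'I_n) : \sum_i (i == k)%:R = 1 :> R.
  by rewrite (bigD1 k) //= eqxx big1 ?addr0 // => z /negPf ->.
rewrite /G eqxx (negPf yx) eqxx !delta !mul1r mulrA -expr2; congr (_ * _).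
apply: eq_bigr => v /andP[/negPf -> /negPf ->].
by rewrite sumr_const card_ord.
Qed.

End HilbertSchmidt.
(** The factor n turns the entries of X, normalised so that matrix products are
  means over the middle vertex, into the values of the corresponding kernel. *)
Definition density (R : realFieldType) (V E : finType) (s t : E -> V) n (X : 'M[R]_n) : R :=
  n%:R ^- #|V| * \sum_(g : {ffun V -> 'I_n}) \prod_e (n%:R * X (g (s e)) (g (t e))).

(** * Matrices that are close in the cut norm *)

(** Here W is the rescaled adjacency matrix and K the averaged kernel, with
  l = m + 2.  The constants C, B0, B1, Bq are common to all n, whereas d tends
  to 0: [close_hs], [close_moment] and [close_degree] are the boundedness of the
  densities of the cycle, of parallel subdivided edges and of a star. *)
Record close_pair (R : realFieldType) (C : R) (m : nat) (B0 B1 : R)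
    (Bq : nat -> R) (d : R) n (W K : 'M[R]_n) : Prop := ClosePair {
  close_size : (0 < n)%N;
  close_W_ge0 : forall i j, 0 <= W i j;
  close_K_ge0 : forall i j, 0 <= K i j;
  close_K_le : forall i j, K i j <= C / n%:R;
  close_W_sym : W^T = W;
  close_K_sym : K^T = K;
  close_hs : hs (W ^+ m.+1) <= B1;
  close_moment : forall q, \sum_i \sum_j (n%:R * (W ^+ m.+2) i j) ^+ q <= Bq q * n%:R ^+ 2;
  close_degree : \sum_i (\sum_j W i j) ^+ 4 <= B0 * n%:R;
  close_cut : forall f g : 'I_n -> R,
    (forall i, 0 <= f i <= 1) -> (forall i, 0 <= g i <= 1) ->
    `|\sum_i \sum_j f i * (W - K) i j * g j| <= n%:R * d }.

Section ClosePairs.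
Variables (R : realFieldType) (C : R) (m : nat) (B0 B1 : R) (Bq : nat -> R).
Hypothesis C_ge1 : 1 <= C.
Local Notation close := (close_pair C m B0 B1 Bq).

(** A quantity is small when it tends to 0 with d, uniformly over all n and all
  pairs with the same constants: K may depend on the rearrangement that was
  chosen, not only on n. *)
Definition small (q : forall n, 'M[R]_n -> 'M[R]_n -> R) :=
  forall e, 0 < e -> exists2 d0, 0 < d0 &
    forall d n (W K : 'M[R]_n), d <= d0 -> close d W K -> q n W K <= e.

(** The shape of a truncation estimate: the truncation level is chosen from e,
  and d comes afterwards. *)
Lemma small_affine (q : forall n, 'M[R]_n -> 'M[R]_n -> R) :
  (forall e, 0 < e -> exists2 c, 0 <= c &
     forall d n (W K : 'M[R]_n), 0 <= d <= 1 -> close d W K -> q n W K <= c * d + e) ->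
  small q.
Proof.
move=> H e e0; have e2 : 0 < e / 2 by rewrite divr_gt0.
have [c c0 Hc] := H _ e2.
have c1 : 0 < c + 1 by rewrite ltr_wpDl.
exists (Num.min 1 (e / 2 / (c + 1))); first by rewrite lt_min ltr01 divr_gt0.
move=> d n W K; rewrite le_min => /andP[d1 dc] cl.
have d0 : 0 <= d.
  have n0 := close_size cl.
  (* the cut condition on zero functions forces d to be nonnegative *)
  have := close_cut cl (f := fun=> 0) (g := fun=> 0).
  rewrite lexx ler01 => /(_ (fun=> isT) (fun=> isT)) /(le_trans (normr_ge0 _)).
  by rewrite pmulr_rge0 // ltr0n.
apply: (le_trans (Hc d n W K _ cl)); first by rewrite d0.
rewrite [leRHS](_ : _ = e / 2 + e / 2); last by field.
rewrite lerD2r; apply: (@le_trans _ _ ((c + 1) * d)); first by rewrite ler_wpM2r // lerDl.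
by rewrite mulrC -ler_pdivlMr.
Qed.

Lemma small_le (c : R) (q q' : forall n, 'M[R]_n -> 'M[R]_n -> R) : 0 <= c ->
  small q ->
  (forall d n (W K : 'M[R]_n), close d W K -> q' n W K <= c * q n W K) -> small q'.
Proof.
move=> c0 sq H e e0; have c1 : 0 < c + 1 by rewrite ltr_wpDl.
have [d0 d00 Hd] := sq (e / (c + 1)) (divr_gt0 e0 c1).
exists d0 => // d n W K dd cl; apply: (le_trans (H d n W K cl)).
apply: (le_trans (ler_wpM2l c0 (Hd d n W K dd cl))).
by rewrite mulrA ler_pdivrMr // mulrC ler_wpM2l ?(ltW e0) // lerDl.
Qed.

Lemma small_add (q q' : forall n, 'M[R]_n -> 'M[R]_n -> R) :
  small q -> small q' -> small (fun n W K => q n W K + q' n W K).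
Proof.
move=> s s' e e0; have e2 : 0 < e / 2 by rewrite divr_gt0.
have [d d0 H] := s _ e2; have [d' d'0 H'] := s' _ e2.
exists (Num.min d d') => [|x n W K]; first by rewrite lt_min d0.
rewrite le_min => /andP[xd xd'] cl.
by rewrite (splitr e) lerD ?(H x) ?(H' x).
Qed.

Lemma small_root (b : R) k (q t : forall n, 'M[R]_n -> 'M[R]_n -> R) :
  0 <= b -> small t ->
  (forall d n (W K : 'M[R]_n), close d W K -> q n W K ^+ k.+1 <= b * t n W K) ->
  small q.
Proof.
move=> b0 st H e e0; have ek : 0 < e ^+ k.+1 by rewrite exprn_gt0.
have st' := small_le b0 st (fun d n W K cl => lexx (b * t n W K)).
have [d0 d00 Hd] := st' _ ek.
exists d0 => // d n W K dd cl.
have [q0|/ltW q0] := lerP 0 (q n W K); last exact: (le_trans q0 (ltW e0)).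
rewrite -(@ler_pXn2r _ k.+1) // ?nnegrE ?(ltW e0) //.
by apply: (le_trans (H d n W K cl)); exact: Hd dd cl.
Qed.

Section Instance.
Variables (d : R) (n : nat) (W K : 'M[R]_n).
Hypothesis cl : close d W K.
Let n0 : 0 < n%:R :> R. Proof. by rewrite ltr0n (close_size cl). Qed.
Let C0 : 0 <= C. Proof. exact: le_trans C_ge1. Qed.
Let W0 := close_W_ge0 cl.
Let K0 := close_K_ge0 cl.
Let KC := close_K_le cl.
Let sW : W^T = W := close_W_sym cl.
Let sK : K^T = K := close_K_sym cl.

Let symE (X : 'M[R]_n) i j : X^T = X -> X i j = X j i.
Proof. by move=> sX; rewrite -[in LHS]sX mxE. Qed.

(** The row sum of the entrywise bound of [dev_le] on [W - K]. *)
Definition degree (W : 'M[R]_n) i := \sum_j W i j + C.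

Lemma degree_geC i : C <= degree W i.
Proof. by rewrite lerDr sumr_ge0. Qed.

Lemma degree_ge0 i : 0 <= degree W i.
Proof. exact: le_trans (degree_geC i). Qed.

Lemma dev_le i j : `|(W - K) i j| <= W i j + C / n%:R.
Proof.
have := W0 i j; have := K0 i j; have := KC i j; rewrite !mxE ler_norml.
by move: (C / _) (W i j) (K i j) => c w k h1 h2 h3; apply/andP; split; lra.
Qed.

(** The cut norm controls the part of the form where f and g are at most M.  On
  the rest f i * g j is at most (f i ^+ 2 * g j + f i * g j ^+ 2) / M, hence at
  most (f i ^+ 3 + g j ^+ 3) / M, and one of the two summations only
  produces a degree. *)
Lemma truncated_form (M : R) (f g : 'I_n -> R) : 0 < M ->
  (forall i, 0 <= f i) -> (forall i, 0 <= g i) ->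
  `|\sum_i \sum_j f i * (W - K) i j * g j| <=
    n%:R * M ^+ 2 * d + M^-1 * \sum_i degree W i * (f i ^+ 3 + g i ^+ 3).
Proof.
move=> M0 f0 g0.
pose cutoff (x : R) := if x <= M then x else 0.
have cut01 x : 0 <= x -> 0 <= cutoff x / M <= 1.
  move=> x0; rewrite /cutoff; case: ifP => xM; last by rewrite mul0r lexx ler01.
  by rewrite divr_ge0 ?(ltW M0) // ler_pdivrMr // mul1r.
have := close_cut cl (f := fun i => cutoff (f i) / M) (g := fun i => cutoff (g i) / M)
  (fun i => cut01 _ (f0 i)) (fun i => cut01 _ (g0 i)).
set S1 := (\sum_i \sum_j _) => HS1.
have -> : \sum_i \sum_j f i * (W - K) i j * g j = M ^+ 2 * S1 +
    \sum_i \sum_j (f i * g j - cutoff (f i) * cutoff (g j)) * (W - K) i j.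
  rewrite mulr_sumr -big_split /=; apply: eq_bigr => i _.
  rewrite mulr_sumr -big_split /=; apply: eq_bigr => j _.
  by field; rewrite gt_eqF.
apply: (le_trans (ler_normD _ _)); apply: lerD.
  rewrite normrM (ger0_norm (sqr_ge0 M)) [leRHS](_ : _ = M ^+ 2 * (n%:R * d)); last by ring.
  by apply: ler_wpM2l HS1; exact: sqr_ge0.
have err i j : `|f i * g j - cutoff (f i) * cutoff (g j)| <= M^-1 * (f i ^+ 3 + g j ^+ 3).
  have F := f0 i; have G := g0 j; move: (f i) (g j) F G => a b a0 b0.
  have cube : a ^+ 2 * b + a * b ^+ 2 <= a ^+ 3 + b ^+ 3.
    rewrite -subr_ge0 (_ : _ - _ = (a + b) * (a - b) ^+ 2); last by ring.
    by rewrite mulr_ge0 ?sqr_ge0 ?addr_ge0.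
  have a2b : 0 <= a ^+ 2 * b by rewrite mulr_ge0 ?sqr_ge0.
  have ab2 : 0 <= a * b ^+ 2 by rewrite mulr_ge0 ?sqr_ge0.
  rewrite ler_pdivlMl // /cutoff; case: (lerP a M) => aM; case: (lerP b M) => bM.
  - by rewrite subrr normr0 mulr0 addr_ge0 // exprn_ge0.
  - rewrite mulr0 subr0 ger0_norm ?mulr_ge0 //; apply: le_trans cube.
    rewrite -[leLHS]add0r lerD // mulrCA ler_wpM2l // expr2 ler_wpM2r // ltW //.
  - rewrite mul0r subr0 ger0_norm ?mulr_ge0 //; apply: le_trans cube.
    rewrite -[leLHS]addr0 lerD // mulrA ler_wpM2r // expr2 ler_wpM2r // ltW //.
  - rewrite mul0r subr0 ger0_norm ?mulr_ge0 //; apply: le_trans cube.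
    rewrite -[leLHS]addr0 lerD // mulrA ler_wpM2r // expr2 ler_wpM2r // ltW //.
have -> : \sum_i degree W i * (f i ^+ 3 + g i ^+ 3) =
    \sum_i \sum_j (W i j + C / n%:R) * (f i ^+ 3 + g j ^+ 3).
  have degE i : degree W i = \sum_j (W i j + C / n%:R).
    rewrite big_split /= sumr_const card_ord -(mulr_natr (C / _)) /degree.
    by rewrite divfK // gt_eqF.
  under [in RHS]eq_bigr => i _ do
    (under eq_bigr do rewrite mulrDr; rewrite big_split /= -mulr_suml -degE).
  rewrite big_split /= [X in _ = _ + X]exchange_big /=.
  under [X in _ = _ + X]eq_bigr => j _ do
    (under eq_bigr => i _ do rewrite (symE i j sW); rewrite -mulr_suml -degE).
  by rewrite -big_split /=; apply: eq_bigr => i _; rewrite mulrDr.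
rewrite mulr_sumr; apply: (le_trans (ler_norm_sum _ _ _)); apply: ler_sum => i _.
rewrite mulr_sumr; apply: (le_trans (ler_norm_sum _ _ _)); apply: ler_sum => j _.
by rewrite normrM mulrCA mulrC; apply: ler_pM => //; exact: dev_le.
Qed.

Lemma degree_moment : \sum_i degree W i ^+ 4 <= (8 * B0 + 8 * C ^+ 4) * n%:R.
Proof.
have H (a b : R) : 0 <= a -> 0 <= b -> (a + b) ^+ 4 <= 8 * a ^+ 4 + 8 * b ^+ 4.
  move=> a0 b0; rewrite -subr_ge0.
  rewrite (_ : _ - _ = (a - b) ^+ 2 * (7 * a ^+ 2 + 10 * (a * b) + 7 * b ^+ 2)); last by ring.
  by rewrite mulr_ge0 ?sqr_ge0 // !addr_ge0 // mulr_ge0 ?sqr_ge0 // mulr_ge0.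
apply: (@le_trans _ _ (\sum_i (8 * (\sum_j W i j) ^+ 4 + 8 * C ^+ 4))).
  by apply: ler_sum => i _; apply: H => //; exact: sumr_ge0.
rewrite big_split /= -mulr_sumr sumr_const card_ord -(mulr_natr (8 * _)).
rewrite [leRHS](_ : _ = 8 * (B0 * n%:R) + 8 * C ^+ 4 * n%:R); last by ring.
by apply: lerD => //; apply: ler_wpM2l => //; exact: close_degree cl.
Qed.

Lemma mulW_le (h : 'I_n -> R) i : (forall j, 0 <= h j <= C) ->
  0 <= \sum_j W i j * h j <= C * degree W i.
Proof.
move=> hC; apply/andP; split.
  by apply: sumr_ge0 => j _; rewrite mulr_ge0 //; case/andP: (hC j).
apply: (@le_trans _ _ (C * \sum_j W i j)); last by rewrite ler_wpM2l // lerDl.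
rewrite mulr_sumr; apply: ler_sum => j _; rewrite mulrC ler_wpM2r //.
by case/andP: (hC j).
Qed.

Lemma mulK_le (h : 'I_n -> R) i : (forall j, 0 <= h j <= C) ->
  0 <= \sum_j K i j * h j <= C * degree W i.
Proof.
move=> hC; apply/andP; split.
  by apply: sumr_ge0 => j _; rewrite mulr_ge0 //; case/andP: (hC j).
apply: (@le_trans _ _ (C * C)); last by rewrite ler_wpM2l // degree_geC.
apply: (@le_trans _ _ (\sum_(j < n) (C / n%:R) * C)).
  apply: ler_sum => j _; have /andP[h0 h1] := hC j.
  by apply: ler_pM.
by rewrite sumr_const card_ord -(mulr_natr (_ * C)) mulrAC divfK ?gt_eqF.
Qed.

Lemma opW q (Y : 'M[R]_(n, q)) : hs (W *m Y) <= (B1 + 1) * hs Y.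
Proof.
apply: (le_trans (hs_pow_bound m Y sW)).
by rewrite ler_wpM2r ?hs_ge0 // lerD2r (close_hs cl).
Qed.

Lemma hsK : hs K <= C ^+ 2.
Proof.
apply: (@le_trans _ _ (\sum_(i < n) \sum_(j < n) (C / n%:R) ^+ 2)).
  by do 2 (apply: ler_sum => ? _); apply: lerXn2r; rewrite ?nnegrE // divr_ge0 // ltW.
rewrite !sumr_const card_ord -mulrnA -(mulr_natr (_ ^+ 2)) natrM expr_div_n expr2.
by rewrite -(expr2 n%:R) divfK // expf_neq0 // gt_eqF.
Qed.

Lemma opK q (Y : 'M[R]_(n, q)) : hs (K *m Y) <= C ^+ 2 * hs Y.
Proof. by apply: (le_trans (hs_mulmx _ _)); rewrite ler_wpM2r ?hs_ge0 // hsK. Qed.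

Lemma opD q (Y : 'M[R]_(n, q)) : hs ((W - K) *m Y) <= (2 * (B1 + 1) + 2 * C ^+ 2) * hs Y.
Proof.
rewrite mulmxBl; apply: (le_trans (hs_sub _ _)).
rewrite [leRHS](_ : _ = 2 * ((B1 + 1) * hs Y) + 2 * (C ^+ 2 * hs Y)); last by ring.
by apply: lerD; apply: ler_wpM2l => //; [exact: opW|exact: opK].
Qed.

Lemma B1_ge0 : 0 <= B1.
Proof. exact: le_trans (hs_ge0 _) (close_hs cl). Qed.

Lemma opW_pow k q (Y : 'M[R]_(n, q)) : hs (W ^+ k *m Y) <= (B1 + 1) ^+ k * hs Y.
Proof.
elim: k => [|k IH]; first by rewrite !expr0 mul1r mul1mx.
rewrite exprS -mulmxE -mulmxA; apply: (le_trans (opW _)).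
by rewrite exprS -mulrA ler_wpM2l // addr_ge0 // B1_ge0.
Qed.

Lemma symX k : (W ^+ k)^T = W ^+ k.
Proof.
elim: k => [|k IH]; first by rewrite expr0 trmx1.
by rewrite [in LHS]exprS -mulmxE trmx_mul IH sW mulmxE -exprSr.
Qed.

Lemma symD : (W - K)^T = W - K.
Proof. by rewrite linearB /= sW sK. Qed.

(** Functions dominated by the degrees have enough moments: the error term is
  then a fourth moment of the degrees. *)
Lemma form_le_degree (M : R) (f g : 'I_n -> R) : 0 < M ->
  (forall i, 0 <= f i <= C * degree W i) -> (forall i, 0 <= g i <= C * degree W i) ->
  `|\sum_i \sum_j f i * (W - K) i j * g j| <=
    n%:R * (M ^+ 2 * d + M^-1 * (2 * C ^+ 3 * (8 * B0 + 8 * C ^+ 4))).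
Proof.
move=> M0 fC gC.
have f0 i : 0 <= f i by case/andP: (fC i).
have g0 i : 0 <= g i by case/andP: (gC i).
apply: (le_trans (truncated_form M0 f0 g0)).
rewrite mulrDr mulrA lerD2l mulrCA ler_wpM2l ?invr_ge0 ?(ltW M0) //.
have C3 : 0 <= 2 * C ^+ 3 by rewrite mulr_ge0 // exprn_ge0.
apply: (@le_trans _ _ (\sum_i 2 * C ^+ 3 * degree W i ^+ 4)); last first.
  rewrite -mulr_sumr [leRHS]mulrCA; apply: ler_wpM2l => //.
  by rewrite [leRHS]mulrC; exact: degree_moment.
apply: ler_sum => i _; have dg := degree_ge0 i.
rewrite [leRHS](_ : _ = degree W i * ((C * degree W i) ^+ 3 + (C * degree W i) ^+ 3)); last by ring.
rewrite ler_wpM2l // lerD // lerXn2r ?nnegrE ?mulr_ge0 //.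
  by case/andP: (fC i).
by case/andP: (gC i).
Qed.

(** For each column h of n *: K, the form of D is applied to D h and h; the two
  parts W h and K h of D h, as well as h itself, are dominated by the degrees. *)
Lemma hs_devK_bound (M : R) : 0 < M ->
  hs ((W - K) *m K) <= 2 * (M ^+ 2 * d + M^-1 * (2 * C ^+ 3 * (8 * B0 + 8 * C ^+ 4))).
Proof.
move=> M0; have nn : n%:R != 0 :> R by rewrite gt_eqF.
rewrite /hs exchange_big /=.
apply: (@le_trans _ _ (\sum_(v < n) n%:R^-1 *
   (2 * (M ^+ 2 * d + M^-1 * (2 * C ^+ 3 * (8 * B0 + 8 * C ^+ 4)))))); last first.
  by rewrite -mulr_suml sumr_const card_ord -(mulr_natr n%:R^-1) mulVf // mul1r.
apply: ler_sum => v _; pose h y := n%:R * K y v.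
have hC y : 0 <= h y <= C.
  by rewrite mulr_ge0 // ?(ltW n0) //= /h mulrC -ler_pdivlMr.
have hdeg y : 0 <= h y <= C * degree W y.
  have /andP[-> hy] := hC y; rewrite (le_trans hy) // ler_peMr //.
  exact: le_trans (degree_geC y).
have := form_le_degree M0 (fun i => mulW_le i hC) hdeg.
have := form_le_degree M0 (fun i => mulK_le i hC) hdeg.
set FK := (\sum_i _); set FW := (\sum_i _); set b := (_ + _) => hK hW.
have -> : \sum_i ((W - K) *m K) i v ^+ 2 = n%:R^-2 * (FW - FK).
  rewrite -sumrN -big_split mulr_sumr; apply: eq_bigr => i _ /=.
  rewrite [in LHS]expr2 {1}mxE mxE mulr_sumr -sumrN -big_split mulr_sumr.
  apply: eq_bigr => j _ /=; rewrite -!mulrBl /h.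
  have -> : \sum_y (W - K) i y * K y v = n%:R^-1 *
      (\sum_y W i y * (n%:R * K y v) - \sum_y K i y * (n%:R * K y v)).
    rewrite -sumrN -big_split mulr_sumr; apply: eq_bigr => y _ /=.
    by rewrite !mxE; field.
  by rewrite !mxE; field.
have -> : n%:R^-1 * (2 * b) = n%:R^-2 * (n%:R * b + n%:R * b) by field.
rewrite ler_wpM2l ?invr_ge0 ?sqr_ge0 //.
by apply: (le_trans (ler_norm _)); apply: (le_trans (ler_normB _ _)); exact: lerD.
Qed.

(** An entry of the matrix is the form of D at two rows of W^(m + 2); the third
  moments of the rows, weighted by the degrees, are square-summable because of
  the moments of order 12 of W^(m + 2) and of order 4 of the degrees. *)
Lemma hs_WlDWl_bound (M : R) : 1 <= M -> 0 <= d <= 1 ->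
  hs (W ^+ m.+2 *m (W - K) *m W ^+ m.+2) <=
   2 * M ^+ 4 * d + M^-1 * (8 * `|8 * B0 + 8 * C ^+ 4 + Bq 12|).
Proof.
move=> M1 /andP[d0 d1]; have M0 : 0 < M by exact: lt_le_trans M1.
have nn : n%:R != 0 :> R by rewrite gt_eqF.
pose f u i := n%:R * (W ^+ m.+2) u i.
have Wk0 k i j : 0 <= (W ^+ k) i j.
  elim: k i j => [|k IH] i j; first by rewrite expr0 mxE ler0n.
  by rewrite exprS -mulmxE mxE sumr_ge0 // => z _; rewrite mulr_ge0.
have f0 u i : 0 <= f u i by rewrite mulr_ge0 // ltW.
pose a u := \sum_i degree W i * f u i ^+ 3.
have entry u v : (W ^+ m.+2 *m (W - K) *m W ^+ m.+2) u v =
    n%:R^-2 * \sum_i \sum_j f u i * (W - K) i j * f v j.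
  rewrite mxE [in RHS]exchange_big mulr_sumr; apply: eq_bigr => j _ /=.
  rewrite mxE mulr_suml; rewrite mulr_sumr; apply: eq_bigr => i _.
  by rewrite /f (symE j v (symX _)); field.
have form u v : (\sum_i \sum_j f u i * (W - K) i j * f v j) ^+ 2 <=
    2 * (n%:R * M ^+ 2 * d) ^+ 2 + 4 * M^-2 * (a u ^+ 2 + a v ^+ 2).
  have := truncated_form M0 (f0 u) (f0 v).
  have -> : \sum_i degree W i * (f u i ^+ 3 + f v i ^+ 3) = a u + a v.
    by rewrite -big_split; apply: eq_bigr => i _; rewrite mulrDr.
  set S := (\sum_i _) => HS.
  have a0 w : 0 <= a w.
    by apply: sumr_ge0 => i _; rewrite mulr_ge0 ?degree_ge0 // exprn_ge0.
  rewrite -real_normK ?num_real //.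
  apply: (@le_trans _ _ ((n%:R * M ^+ 2 * d + M^-1 * (a u + a v)) ^+ 2)).
    by apply: lerXn2r => //; rewrite nnegrE // (le_trans _ HS).
  rewrite -subr_ge0 -exprVn; set x := n%:R * _ * _; set y := M^-1.
  rewrite (_ : _ - _ = (x - y * (a u + a v)) ^+ 2 + 2 * y ^+ 2 * (a u - a v) ^+ 2); last by ring.
  apply: addr_ge0; first exact: sqr_ge0.
  by apply: mulr_ge0; [apply: mulr_ge0 => //; exact: sqr_ge0|exact: sqr_ge0].
have suma : \sum_u a u ^+ 2 <= n%:R ^+ 3 * (8 * B0 + 8 * C ^+ 4 + Bq 12).
  apply: (@le_trans _ _ (\sum_u n%:R * \sum_i (degree W i ^+ 4 + f u i ^+ 12))).
    apply: ler_sum => u _; apply: (le_trans (sum_sqr_le _)); rewrite card_ord.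
    rewrite ler_wpM2l ?(ltW n0) //; apply: ler_sum => i _.
    rewrite -subr_ge0; set x := degree _ _; set y := f u i.
    rewrite (_ : _ - _ = ((x ^+ 2 - y ^+ 6) ^+ 2 + x ^+ 4 + y ^+ 12) / 2); last by field.
    rewrite divr_ge0 // !addr_ge0 ?sqr_ge0 // ?exprn_ge0 ?f0 //; exact: degree_ge0.
  rewrite -mulr_sumr exprS -mulrA ler_wpM2l ?(ltW n0) //.
  under eq_bigr do rewrite big_split /=.
  rewrite big_split /= sumr_const card_ord -(mulr_natr (\sum_i _)).
  rewrite [leRHS](_ : _ = (8 * B0 + 8 * C ^+ 4) * n%:R * n%:R + Bq 12 * n%:R ^+ 2); last by ring.
  apply: lerD; last exact: close_moment cl 12.
  by rewrite ler_wpM2r ?(ltW n0) // degree_moment.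
have -> : hs (W ^+ m.+2 *m (W - K) *m W ^+ m.+2) = \sum_u \sum_v
     n%:R^-4 * (\sum_i \sum_j f u i * (W - K) i j * f v j) ^+ 2.
  apply: eq_bigr => u _; apply: eq_bigr => v _; rewrite entry exprMn.
  by rewrite -exprVn -exprM exprVn.
apply: (@le_trans _ _ (\sum_u \sum_v n%:R^-4 *
   (2 * (n%:R * M ^+ 2 * d) ^+ 2 + 4 * M^-2 * (a u ^+ 2 + a v ^+ 2)))).
  by do 2 (apply: ler_sum => ? _); rewrite ler_wpM2l ?invr_ge0 ?exprn_ge0 // ltW.
have -> : \sum_u \sum_v n%:R^-4 * (2 * (n%:R * M ^+ 2 * d) ^+ 2 +
      4 * M^-2 * (a u ^+ 2 + a v ^+ 2)) =
    n%:R^-4 * (n%:R ^+ 2 * (2 * (n%:R * M ^+ 2 * d) ^+ 2) +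
      4 * M^-2 * (2 * n%:R * \sum_u a u ^+ 2)).
  move: (n%:R^-4) (2 * _) (4 * _) => k A D.
  have lin c e (x : 'I_n -> R) : \sum_v (c + e * x v) = n%:R * c + e * \sum_v x v.
    by rewrite big_split sumr_const card_ord -(mulr_natl c) mulr_sumr.
  under eq_bigr => u _.
    rewrite -mulr_sumr.
    under eq_bigr => v _ do rewrite mulrDr addrA.
    rewrite lin (_ : _ + _ = n%:R * A + D * (\sum_i a i ^+ 2) + n%:R * D * a u ^+ 2); last by ring.
    over.
  by rewrite -mulr_sumr lin; ring.
set B := 8 * B0 + _ + _ in suma *.
have M2 : M^-2 <= M^-1.
  by rewrite lef_pV2 ?posrE ?exprn_gt0 // expr2 ler_peMl // ltW.
have Mi : 0 <= M^-1 by rewrite invr_ge0 ltW.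
apply: (@le_trans _ _ (2 * M ^+ 4 * d ^+ 2 + 8 * M^-2 * B)).
  apply: (@le_trans _ _ (n%:R^-4 * (n%:R ^+ 2 * (2 * (n%:R * M ^+ 2 * d) ^+ 2) +
      4 * M^-2 * (2 * n%:R * (n%:R ^+ 3 * B))))).
    rewrite ler_wpM2l ?invr_ge0 ?exprn_ge0 ?(ltW n0) // lerD2l ler_wpM2l //.
      by rewrite mulr_ge0 // invr_ge0 exprn_ge0 // ltW.
    by rewrite ler_wpM2l // mulr_ge0 // ltW.
  by rewrite le_eqVlt; apply/orP; left; apply/eqP; field; rewrite nn gt_eqF.
apply: lerD.
  rewrite ler_wpM2l ?mulr_ge0 ?exprn_ge0 ?(ltW M0) // expr2 -[leRHS]mulr1.
  by rewrite ler_wpM2l.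
rewrite (mulrC 8) -mulrA; apply: (@le_trans _ _ (M^-2 * (8 * `|B|))).
  apply: ler_wpM2l; first by rewrite invr_ge0 exprn_ge0 // ltW.
  by apply: ler_wpM2l => //; exact: ler_norm.
by apply: ler_wpM2r => //; rewrite mulr_ge0.
Qed.

End Instance.
Lemma small_devK : small (fun n W K => hs ((W - K) *m K)).
Proof.
apply: small_affine => e e0.
set N := 2 * C ^+ 3 * (8 * B0 + 8 * C ^+ 4).
have N0 : 0 < 2 * `|N| + 1 by rewrite ltr_wpDl // mulr_ge0.
exists (2 * ((2 * `|N| + 1) / e) ^+ 2) => [|d n W K _ cl].
  by rewrite mulr_ge0 // sqr_ge0.
have M0 : 0 < (2 * `|N| + 1) / e by rewrite divr_gt0.
apply: (le_trans (hs_devK_bound cl M0)); rewrite -/N.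
set M := (2 * `|N| + 1) / e in M0 *.
rewrite [leLHS](_ : _ = 2 * M ^+ 2 * d + 2 * N / M); last by ring.
apply: lerD => //; rewrite ler_pdivrMr // [e * M]mulrC /M divfK ?gt_eqF //.
by rewrite (@le_trans _ _ (2 * `|N|)) ?lerDl // ler_wpM2l // ler_norm.
Qed.

Lemma small_Kdev : small (fun n W K => hs (K *m (W - K))).
Proof.
apply: (small_le (c := 1) _ small_devK) => // d n W K cl.
by rewrite -hs_tr trmx_mul (symD cl) (close_K_sym cl) mul1r.
Qed.

Lemma small_WlDWl : small (fun n W K => hs (W ^+ m.+2 *m ((W - K) *m W ^+ m.+2))).
Proof.
apply: small_affine => e e0.
set N := 8 * `|8 * B0 + 8 * C ^+ 4 + Bq 12|.
have N0 : 0 <= N by rewrite mulr_ge0.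
have M1 : 1 <= N / e + 1 by rewrite lerDr divr_ge0 // ltW.
exists (2 * (N / e + 1) ^+ 4) => [|d n W K d01 cl].
  by rewrite mulr_ge0 // exprn_ge0 // (le_trans ler01).
rewrite mulmxA; apply: (le_trans (hs_WlDWl_bound cl M1 d01)).
rewrite lerD2l -/N mulrC ler_pdivrMr ?(lt_le_trans _ M1) // mulrDr mulr1.
by rewrite mulrCA divff ?gt_eqF // mulr1 lerDl ltW.
Qed.

(** Log-convexity interpolates between the exponent 0, where the norm is
  bounded, and the exponent k + 1, where it is small. *)
Lemma small_lower (q : forall n, 'M[R]_n -> 'M[R]_n -> 'M[R]_n) k (b : R) :
  0 <= b ->
  (forall d n (W K : 'M[R]_n), close d W K -> hs (q n W K) <= b) ->
  small (fun n W K => hs (W ^+ k.+1 *m q n W K)) ->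
  small (fun n W K => hs (W *m q n W K)).
Proof.
move=> b0 bq sq; apply: (small_root (k := k) (exprn_ge0 k b0) sq) => d n W K cl.
apply: (le_trans (hs_pow_endpoint _ _ (close_W_sym cl))).
by rewrite ler_wpM2r ?hs_ge0 // lerXn2r ?nnegrE ?hs_ge0 // (bq _ _ _ _ cl).
Qed.

(** [small_lower] is used on the left of W^l D W^l, giving W D W^l; multiplying by
  powers of W and transposing gives W^l D W^(l-1), and a second use gives
  W D W^(l-1).  Subtracting K D W^(l-1) yields D D W^(l-1), whose inner product
  with W^(l-1) is the squared norm of D W^(l-1). *)
Lemma small_WD : 0 <= B1 -> small (fun n W K => hs (W ^+ m.+1 *m (W - K))).
Proof.
move=> B1_0.
have C0 : 0 <= C by exact: le_trans C_ge1.
pose b := (2 * (B1 + 1) + 2 * C ^+ 2) * ((B1 + 1) * B1).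
have bD : 0 <= 2 * (B1 + 1) + 2 * C ^+ 2.
  by rewrite addr_ge0 ?mulr_ge0 ?sqr_ge0 // addr_ge0.
have b0 : 0 <= b by rewrite /b !mulr_ge0 // addr_ge0.
have hsWl d n (W K : 'M[R]_n) : close d W K -> hs (W ^+ m.+2) <= (B1 + 1) * B1.
  move=> cl; rewrite exprS -mulmxE; apply: (le_trans (opW cl _)).
  by rewrite ler_wpM2l ?addr_ge0 // (close_hs cl).
have s1 : small (fun n W K => hs (W *m ((W - K) *m W ^+ m.+2))).
  apply: (small_lower b0 _ small_WlDWl) => d n W K cl.
  by apply: (le_trans (opD cl _)); rewrite ler_wpM2l // (hsWl _ _ _ _ cl).
have s2 : small (fun n W K => hs (W ^+ m.+2 *m ((W - K) *m W ^+ m.+1))).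
  apply: (small_le (c := (B1 + 1) ^+ m) _ s1) => [|d n W K cl].
    by rewrite exprn_ge0 // addr_ge0.
  rewrite -hs_tr trmx_mul (symX cl m.+2) trmx_mul (symX cl m.+1) (symD cl) -mulmxA.
  have -> : W ^+ m.+1 = W ^+ m *m W by rewrite exprSr.
  by rewrite -mulmxA; exact: (opW_pow cl).
have s3 : small (fun n W K => hs (W *m ((W - K) *m W ^+ m.+1))).
  apply: (small_lower b0 _ s2) => d n W K cl.
  apply: (le_trans (opD cl _)); rewrite ler_wpM2l //.
  by apply: (le_trans (close_hs cl)); rewrite mulrDl mul1r lerDr mulr_ge0.
have s4 : small (fun n W K => hs (K *m ((W - K) *m W ^+ m.+1))).
  apply: (small_le (c := B1) _ small_Kdev) => // d n W K cl.
  rewrite mulmxA mulrC; apply: (le_trans (hs_mulmx _ _)).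
  by rewrite ler_wpM2l ?hs_ge0 // (close_hs cl).
apply: (small_root (k := 1) B1_0 (small_add (small_le (c := 2) _ s3 _) (small_le (c := 2) _ s4 _))) => //.
- by move=> d n W K cl; exact: lexx.
- by move=> d n W K cl; exact: lexx.
move=> d n W K cl; rewrite -(hs_tr (_ *m _)) trmx_mul (symX cl m.+1) (symD cl).
rewrite hs_dot mxdot_mulmxl ?(symD cl) //; apply: (le_trans (mxdot_le _ _)).
apply: ler_pM; rewrite ?hs_ge0 // ?(close_hs cl) //.
by rewrite mulmxBl; exact: hs_sub.
Qed.

(** In the telescoping sum of W^l - K^l every term but the first contains the
  small product K D, multiplied by factors of bounded operator norm. *)
Lemma small_dev_pow : 0 <= B1 -> small (fun n W K => hs (W ^+ m.+2 - K ^+ m.+2)).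
Proof.
move=> B1_0; have sWD := small_WD B1_0.
have step n (W K : 'M[R]_n) j : W ^+ j.+1 - K ^+ j.+1 =
    (W - K) *m W ^+ j + K *m (W ^+ j - K ^+ j).
  by rewrite !exprS -!mulmxE mulmxBl mulmxBr addrA subrK.
have sK j : small (fun n W K => hs (K *m (W ^+ j - K ^+ j))).
  elim: j => [|j IH].
    apply: (small_le (c := 0) _ small_Kdev) => // d n W K cl.
    rewrite !expr0 subrr mulmx0 mul0r.
    by rewrite /hs big1 // => ? _; rewrite big1 // => ? _; rewrite mxE expr0n.
  have b0 : 0 <= 2 * (B1 + 1) ^+ j by rewrite mulr_ge0 // exprn_ge0 // addr_ge0.
  have c0 : 0 <= 2 * C ^+ 2 by rewrite mulr_ge0 // sqr_ge0.
  have s := small_add (small_le b0 small_Kdev (fun _ _ _ _ _ => lexx _))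
    (small_le c0 IH (fun _ _ _ _ _ => lexx _)).
  apply: (small_le ler01 s) => d n W K cl; rewrite mul1r step mulmxDr.
  apply: (le_trans (hs_add _ _)); apply: lerD; rewrite -(mulrA 2) ler_wpM2l //.
    rewrite -[leLHS]hs_tr -[X in _ <= _ * X]hs_tr mulmxA trmx_mul (symX cl j).
    exact: (opW_pow cl).
  exact: (opK cl).
have s := small_add (small_le (ler0n _ 2) sWD (fun _ _ _ _ _ => lexx _))
    (small_le (ler0n _ 2) (sK m.+1) (fun _ _ _ _ _ => lexx _)).
apply: (small_le ler01 s) => d n W K cl; rewrite mul1r step.
apply: (le_trans (hs_add _ _)); rewrite lerD2r ler_wpM2l //.
by rewrite -hs_tr trmx_mul (symX cl m.+1) (symD cl).
Qed.

Lemma pow_K_le d n (W K : 'M[R]_n) k i j : close d W K ->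
  0 <= (K ^+ k.+1) i j <= C ^+ k.+1 / n%:R.
Proof.
move=> cl; have K0 := close_K_ge0 cl; have KC := close_K_le cl.
have n0 : 0 < n%:R :> R by rewrite ltr0n (close_size cl).
elim: k i j => [|k IH] i j; first by rewrite !expr1 K0 KC.
rewrite exprS -mulmxE mxE; apply/andP; split.
  by apply: sumr_ge0 => z _; rewrite mulr_ge0 //; case/andP: (IH z j).
apply: (@le_trans _ _ (\sum_(z < n) C / n%:R * (C ^+ k.+1 / n%:R))).
  by apply: ler_sum => z _; have /andP[? ?] := IH z j; apply: ler_pM.
rewrite sumr_const card_ord -(mulr_natl (_ * _)) [C ^+ k.+2]exprS.
by rewrite le_eqVlt; apply/orP; left; apply/eqP; field; rewrite gt_eqF.
Qed.

Lemma pow_W_ge0 d n (W K : 'M[R]_n) k i j : close d W K -> 0 <= (W ^+ k) i j.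
Proof.
move=> cl; elim: k i j => [|k IH] i j; first by rewrite expr0 mxE ler0n.
rewrite exprS -mulmxE mxE sumr_ge0 // => z _; rewrite mulr_ge0 //.
exact: close_W_ge0 cl _ _.
Qed.

(** By telescoping, the products of values of W^l and of K^l differ by at most the
  sum of the differences of single factors times the product of the bounds
  w + C^l + 1 over all edges, w being the value of the kernel W^l.  The
  Cauchy-Schwarz inequality separates the two: the first is the norm of
  W^l - K^l since the ends of an edge are distinct, the second is bounded by
  high moments of W^l. *)
Lemma small_density (V E : finType) (s t : E -> V) :
  0 <= B1 -> (forall e, s e != t e) ->
  small (fun n W K => `|density s t (W ^+ m.+2) - density s t (K ^+ m.+2)|).
Proof.
move=> B1_0 st.
pose r := #|E|; pose k := (r + r)%N; pose c := C ^+ m.+2 + 1.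
have C0 : 0 <= C by exact: le_trans C_ge1.
have c0 : 0 <= c by rewrite addr_ge0 // exprn_ge0.
pose b := r%:R ^+ 2 * (2 + 2 * r%:R ^+ 2 * (2 ^+ k * (`|Bq k| + c ^+ k))).
have b0 : 0 <= b.
  rewrite mulr_ge0 ?sqr_ge0 // addr_ge0 // !mulr_ge0 ?sqr_ge0 ?exprn_ge0 //.
  by rewrite addr_ge0 // exprn_ge0.
apply: (small_root (k := 1) b0 (small_dev_pow B1_0)) => d n W K cl.
rewrite -normrX ger0_norm ?sqr_ge0 //.
have n0 : 0 < n%:R :> R by rewrite ltr0n (close_size cl).
have nn : n%:R != 0 :> R by rewrite gt_eqF.
pose w i j := n%:R * (W ^+ m.+2) i j; pose q i j := n%:R * (K ^+ m.+2) i j.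
have w0 i j : 0 <= w i j by rewrite mulr_ge0 ?(ltW n0) // (pow_W_ge0 _ _ _ cl).
have qC i j : 0 <= q i j <= C ^+ m.+2.
  have /andP[q0 qC] := pow_K_le m.+1 i j cl.
  by rewrite mulr_ge0 ?(ltW n0) //= /q mulrC -ler_pdivlMr.
pose u i j := w i j + c.
have u0 i j : 0 <= u i j by rewrite addr_ge0.
pose A (g : {ffun V -> 'I_n}) := \sum_e `|w (g (s e)) (g (t e)) - q (g (s e)) (g (t e))|.
pose P (g : {ffun V -> 'I_n}) := \prod_e u (g (s e)) (g (t e)).
have sumV (F : 'I_n -> 'I_n -> R) e :
    \sum_(g : {ffun V -> 'I_n}) F (g (s e)) (g (t e)) =
    n%:R ^+ #|V| * (n%:R ^- 2 * \sum_i \sum_j F i j).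
  rewrite mulrCA -(sum_ffun_two _ (st e)) mulrA mulVf ?mul1r //.
  by rewrite expf_neq0.
have diff : `|density s t (W ^+ m.+2) - density s t (K ^+ m.+2)| <=
    n%:R ^- #|V| * \sum_g A g * P g.
  rewrite /density -mulrBr normrM ger0_norm ?invr_ge0 ?exprn_ge0 ?(ltW n0) //.
  rewrite ler_wpM2l ?invr_ge0 ?exprn_ge0 ?(ltW n0) // -sumrB.
  apply: (le_trans (ler_norm_sum _ _ _)); apply: ler_sum => g _.
  apply: prod_dist_le => e.
  - by rewrite w0 lerDl.
  - have /andP[-> h] := qC (g (s e)) (g (t e)).
    by rewrite (le_trans h) // /u /c addrCA lerDl addr_ge0.
  - by rewrite /u /c addrA lerDr addr_ge0 // exprn_ge0.
have sumA : \sum_g A g ^+ 2 <= n%:R ^+ #|V| * (r%:R ^+ 2 * hs (W ^+ m.+2 - K ^+ m.+2)).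
  apply: (@le_trans _ _ (\sum_(g : {ffun V -> 'I_n}) r%:R * \sum_e
      (w (g (s e)) (g (t e)) - q (g (s e)) (g (t e))) ^+ 2)).
    apply: ler_sum => g _; apply: (le_trans (sum_sqr_le _)).
    rewrite ler_wpM2l //; apply: ler_sum => e _.
    by rewrite -normrX ger0_norm // sqr_ge0.
  rewrite -mulr_sumr exchange_big /=.
  under eq_bigr => e _ do rewrite (sumV (fun i j => (w i j - q i j) ^+ 2)).
  have -> : \sum_i \sum_j (w i j - q i j) ^+ 2 =
      n%:R ^+ 2 * hs (W ^+ m.+2 - K ^+ m.+2).
    rewrite /hs mulr_sumr; apply: eq_bigr => i _; rewrite mulr_sumr.
    by apply: eq_bigr => j _; rewrite /w /q !mxE; ring.
  rewrite sumr_const -/r -(mulr_natl (n%:R ^+ #|V| * _)).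
  by rewrite le_eqVlt; apply/orP; left; apply/eqP; field.
have sumu e : \sum_(g : {ffun V -> 'I_n}) u (g (s e)) (g (t e)) ^+ k <=
    n%:R ^+ #|V| * (2 ^+ k * (`|Bq k| + c ^+ k)).
  rewrite (sumV (fun i j => u i j ^+ k)) ler_wpM2l ?exprn_ge0 ?(ltW n0) //.
  rewrite mulrC ler_pdivrMr ?exprn_gt0 //.
  apply: (@le_trans _ _ (\sum_i \sum_j 2 ^+ k * (w i j ^+ k + c ^+ k))).
    by do 2 (apply: ler_sum => ? _); exact: exprD_le.
  under eq_bigr => i _ do rewrite -mulr_sumr big_split sumr_const card_ord /=.
  rewrite -mulr_sumr big_split sumr_const card_ord /= -mulrA ler_wpM2l ?exprn_ge0 //.
  rewrite mulrDl; apply: lerD.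
    apply: (le_trans (close_moment cl k)); rewrite ler_wpM2r ?sqr_ge0 //.
    exact: ler_norm.
  by rewrite -mulrnA -(mulr_natr (c ^+ k)) natrM expr2.
have sumP : \sum_g P g ^+ 2 <=
    n%:R ^+ #|V| * (2 + 2 * r%:R ^+ 2 * (2 ^+ k * (`|Bq k| + c ^+ k))).
  apply: (@le_trans _ _ (\sum_(g : {ffun V -> 'I_n})
     (2 + 2 * r%:R * \sum_e u (g (s e)) (g (t e)) ^+ k))).
    apply: ler_sum => g _.
    pose z e := u (g (s e)) (g (t e)).
    have z0 e : 0 <= z e by exact: u0.
    have S0 : 0 <= \sum_e z e ^+ r by apply: sumr_ge0 => e _; rewrite exprn_ge0.
    apply: (@le_trans _ _ ((1 + \sum_e z e ^+ r) ^+ 2)).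
      apply: lerXn2r; rewrite ?nnegrE ?addr_ge0 ?prodr_ge0 //.
      exact: prod_le_sum_exp.
    apply: (@le_trans _ _ (2 + 2 * (\sum_e z e ^+ r) ^+ 2)).
      rewrite -subr_ge0 (_ : _ - _ = (1 - \sum_e z e ^+ r) ^+ 2) ?sqr_ge0 //.
      by ring.
    rewrite lerD2l -mulrA ler_wpM2l //; apply: (le_trans (sum_sqr_le _)).
    rewrite ler_wpM2l //; apply: ler_sum => e _.
    by rewrite -exprM muln2 -addnn.
  rewrite big_split /= sumr_const card_ffun card_ord -(mulr_natl 2) natrX.
  rewrite [leRHS]mulrDr lerD2l -mulr_sumr exchange_big /=.
  rewrite [leRHS](_ : _ = 2 * r%:R * (r%:R * (n%:R ^+ #|V| * (2 ^+ k * (`|Bq k| + c ^+ k))))); last by ring.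
  rewrite ler_wpM2l ?mulr_ge0 //.
  apply: (@le_trans _ _ (\sum_(e : E) n%:R ^+ #|V| * (2 ^+ k * (`|Bq k| + c ^+ k)))).
    by apply: ler_sum => e _; exact: sumu.
  by rewrite sumr_const -/r -(mulr_natl (_ * _)).
apply: (@le_trans _ _ ((n%:R ^- #|V| * \sum_g A g * P g) ^+ 2)).
  rewrite -real_normK ?num_real //; apply: lerXn2r; rewrite ?nnegrE //.
  exact: le_trans diff.
rewrite exprMn; apply: (@le_trans _ _ ((n%:R ^- #|V|) ^+ 2 *
   ((n%:R ^+ #|V| * (r%:R ^+ 2 * hs (W ^+ m.+2 - K ^+ m.+2))) *
    (n%:R ^+ #|V| * (2 + 2 * r%:R ^+ 2 * (2 ^+ k * (`|Bq k| + c ^+ k))))))).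
  rewrite ler_wpM2l ?sqr_ge0 //; apply: (le_trans (cauchy_schwarz _ _)).
  apply: ler_pM => //; apply: sumr_ge0 => g _; exact: sqr_ge0.
rewrite /b; set X := 2 + _; set Y := hs _; set N := n%:R ^+ #|V|.
have N0 : N != 0 by rewrite expf_neq0.
by rewrite le_eqVlt; apply/orP; left; apply/eqP; field.
Qed.

End ClosePairs.
(** * Subdivided multigraphs and powers of matrices *)

Section FiniteFunctions.
Variable (T : finType).

Definition fcons m (z : T) (w : {ffun 'I_m -> T}) : {ffun 'I_m.+1 -> T} :=
  [ffun i => oapp w z (unlift ord0 i)].

Lemma fcons0 m z (w : {ffun 'I_m -> T}) : fcons z w ord0 = z.
Proof. by rewrite ffunE unlift_none. Qed.

Lemma fconsS m z (w : {ffun 'I_m -> T}) i : fcons z w (lift ord0 i) = w i.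
Proof. by rewrite ffunE liftK. Qed.

Lemma sum_ffun_cons (R : nmodType) m (G : {ffun 'I_m.+1 -> T} -> R) :
  \sum_w G w = \sum_z \sum_w G (fcons z w).
Proof.
rewrite pair_bigA /= (reindex (fun p : T * {ffun 'I_m -> T} => fcons p.1 p.2)) //=.
exists (fun w : {ffun 'I_m.+1 -> T} => (w ord0, [ffun i => w (lift ord0 i)])).
  move=> [z w] _ /=; rewrite fcons0; congr (_, _).
  by apply/ffunP => i; rewrite ffunE fconsS.
move=> w _ /=; apply/ffunP => i; case: (unliftP ord0 i) => [j ->|->].
  by rewrite fconsS ffunE.
by rewrite fcons0.
Qed.

End FiniteFunctions.

Section Walks.
Variables (R : realFieldType) (n : nat) (X : 'M[R]_n).

(** The inner vertices of the walk are the values of w; the double product runs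
  over the pairs of consecutive indices, in the form in which they occur in the
  adjacency relation of a subdivision. *)
Definition walk m (a : 'I_n) (w : 'I_m.+1 -> 'I_n) (b : 'I_n) : R :=
  X a (w ord0) * (\prod_(i < m.+1) \prod_(j < m.+1 | i.+1 == j :> nat) X (w i) (w j))
  * X (w ord_max) b.

Lemma walk_cons m a z b (w : {ffun 'I_m.+1 -> 'I_n}) :
  walk a (fcons z w) b = X a z * walk z w b.
Proof.
rewrite /walk fcons0 -!mulrA; congr (_ * _).
have -> : ord_max = lift ord0 (@ord_max m) by apply/val_inj.
rewrite fconsS !mulrA; congr (_ * _).
rewrite big_ord_recl (big_pred1 (lift ord0 ord0)) ?fcons0 ?fconsS; last first.
  by move=> j; rewrite /= -val_eqE eq_sym.
congr (_ * _); apply: eq_bigr => i _.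
rewrite big_mkcond big_ord_recl /= mul1r [RHS]big_mkcond.
by apply: eq_bigr => j _; rewrite !fconsS.
Qed.

Lemma sum_walk m a b :
  \sum_(w : {ffun 'I_m.+1 -> 'I_n}) walk a w b = (X ^+ m.+2) a b.
Proof.
elim: m a b => [|m IH] a b; rewrite sum_ffun_cons exprS -mulmxE mxE; apply: eq_bigr => z _.
  rewrite expr1 (big_pred1 [ffun=> z]); last first.
    by move=> w; apply/esym/eqP/ffunP => -[].
  rewrite /walk (_ : ord_max = ord0); last exact/val_inj.
  by rewrite fcons0 big_ord1 big_pred0 ?mulr1 // => -[[]].
by rewrite -IH mulr_sumr; apply: eq_bigr => w _; exact: walk_cons.
Qed.

End Walks.

Section Weights.
Variables (R : realFieldType) (n : nat) (X : 'M[R]_n).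
Hypotheses (X0 : forall i j, 0 <= X i j) (sX : forall i j, X i j = X j i).

Definition weight k (F : sgraph 'I_k) (f : 'I_k -> 'I_n) : R :=
  \prod_(i < k) \prod_(j < k | (i < j)%N && adj F i j) X (f i) (f j).

(** The product over ordered pairs is the square of [weight].  Unlike [weight] it
  needs no order on the vertices, so it is transported by isomorphisms; no
  information is lost since weights are nonnegative. *)
Definition weight2 (V : finType) (F : sgraph V) (f : V -> 'I_n) : R :=
  \prod_x \prod_(y | adj F x y) X (f x) (f y).

Lemma weight2E k (F : sgraph 'I_k) f : weight2 F f = weight F f ^+ 2.
Proof.
rewrite expr2 /weight [X in _ = _ * X](exchange_big_dep predT) //= -big_split.
apply: eq_bigr => i _ /=.
rewrite (bigID (fun j : 'I_k => (i < j)%N)) /=; congr (_ * _).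
  by apply: eq_bigl => j; rewrite andbC.
apply: eq_big => [j|j _]; last exact: sX.
rewrite -leqNgt leq_eqVlt val_eqE (adj_sym F j i).
by case: eqVneq => [->|_]; rewrite ?(adj_irr F) ?andbF // andbC.
Qed.

Lemma weight2_iso (V U : finType) (F : sgraph V) (H : sgraph U) (phi : V -> U) f :
  bijective phi -> (forall x y, adj H (phi x) (phi y) = adj F x y) ->
  weight2 H f = weight2 F (f \o phi).
Proof.
move=> bphi iso; rewrite /weight2 (reindex phi) /=; last exact: onW_bij.
apply: eq_bigr => x _; rewrite (reindex phi) /=; last exact: onW_bij.
by apply: eq_bigl => y; rewrite iso.
Qed.

(** Each end of a path is seen once from the old vertex and once from the new
  one, and each inner edge once in each direction. *)
Lemma weight2_subdivision m (M : multigraph) (f : subdiv_vertex m.+2 M -> 'I_n) :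
  weight2 (subdivision m.+2 M) f =
  (\prod_e walk X (f (inl (msrc e))) (fun i : 'I_m.+1 => f (inr (e, i)))
                  (f (inl (mtgt e)))) ^+ 2.
Proof.
pose a e (i : 'I_m.+1) := if (i == 0 :> nat) then X (f (inl (msrc e))) (f (inr (e, i))) else 1.
pose b e (i : 'I_m.+1) := if (i.+1 == m.+1)%N then X (f (inr (e, i))) (f (inl (mtgt e))) else 1.
(* as M has no loops, at most one of the two ends of e is u *)
have one u e (i : 'I_m.+1) :
    (if (((i == 0 :> nat) && (u == msrc e)) || ((i.+1 == m.+1) && (u == mtgt e)))%N
     then X (f (inl u)) (f (inr (e, i))) else 1) =
    (if u == msrc e then a e i else 1) * (if u == mtgt e then b e i else 1).
  have ne := mloopless e; 
  case: (eqVneq u (msrc e)) => [->|us].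
    by rewrite (negPf ne) andbT andbF orbF mulr1.
  rewrite andbF /= mul1r /b andbC; case: (eqVneq u (mtgt e)) => [->|] //=.
  by rewrite sX.
have pick e (i : 'I_m.+1) : \prod_u (if (((i == 0 :> nat) && (u == msrc e)) ||
       ((i.+1 == m.+1) && (u == mtgt e)))%N
     then X (f (inl u)) (f (inr (e, i))) else 1) = a e i * b e i.
  under eq_bigr => u _ do rewrite one.
  by rewrite big_split -!big_mkcond !big_pred1_eq.
have ends e : \prod_(i < m.+1) (a e i * b e i) =
    X (f (inl (msrc e))) (f (inr (e, ord0))) * X (f (inr (e, ord_max))) (f (inl (mtgt e))).
  rewrite big_split /=; congr (_ * _); rewrite -big_mkcond.
    by rewrite (big_pred1 ord0).
  by rewrite (big_pred1 ord_max).
rewrite /weight2 big_sumType /=.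
have -> : \prod_(u : mvertex M) \prod_(y | @subdiv_adj m.+2 M (inl u) y) X (f (inl u)) (f y) =
    \prod_e (X (f (inl (msrc e))) (f (inr (e, ord0))) *
             X (f (inr (e, ord_max))) (f (inl (mtgt e)))).
  transitivity (\prod_u \prod_e \prod_(i < m.+1) (if (((i == 0 :> nat) && (u == msrc e)) ||
       ((i.+1 == m.+1) && (u == mtgt e)))%N then X (f (inl u)) (f (inr (e, i))) else 1)).
    apply: eq_bigr => u _; rewrite big_sumType /= big_pred0 // mul1r big_mkcond /=.
    by rewrite pair_bigA; apply: eq_bigr => -[e i] _.
  rewrite exchange_big /=; apply: eq_bigr => e _.
  by rewrite exchange_big /= -ends; apply: eq_bigr => i _; rewrite pick.
have -> : \prod_(z : medge M * 'I_m.+1) \prod_(y | @subdiv_adj m.+2 M (inr z) y)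
      X (f (inr z)) (f y) =
    \prod_e (X (f (inl (msrc e))) (f (inr (e, ord0))) *
             X (f (inr (e, ord_max))) (f (inl (mtgt e))) *
      (\prod_(i < m.+1) \prod_(j < m.+1 | i.+1 == j :> nat)
         X (f (inr (e, i))) (f (inr (e, j)))) ^+ 2).
  transitivity (\prod_e \prod_(i < m.+1) \prod_(y | @subdiv_adj m.+2 M (inr (e, i)) y)
      X (f (inr (e, i))) (f y)).
    by rewrite pair_bigA; apply: eq_bigr => -[e i] _.
  apply: eq_bigr => e _.
  rewrite -ends expr2 [X in _ = _ * (_ * X)](exchange_big_dep predT) //= -!big_split.
  apply: eq_bigr => i _ /=; rewrite big_sumType /=; congr (_ * _).
    rewrite big_mkcond /= -pick; apply: eq_bigr => u _.
    by rewrite sX.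
  transitivity (\prod_e' \prod_(j < m.+1) (if (e == e') && ((i.+1 == j :> nat) ||
     (j.+1 == i :> nat)) then X (f (inr (e, i))) (f (inr (e', j))) else 1)).
    by rewrite pair_bigA big_mkcond; apply: eq_bigr => -[e' j] _.
  rewrite (bigD1 e) //= [X in _ * X = _]big1 ?mulr1 => [|e' /negPf e'e]; last first.
    by rewrite big1 // => j _; rewrite eq_sym e'e.
  rewrite eqxx /= -big_mkcond (bigID (fun j : 'I_m.+1 => i.+1 == j :> nat)) /=.
  congr (_ * _).
    by apply: eq_bigl => j; case: eqP; rewrite ?andbT ?andbF ?orbT.
  apply: eq_big => [j|j _]; last exact: sX.
  by case: (i.+1 =P j :> nat) => [<-|_]; rewrite ?andbT //= gtn_eqF.
rewrite -big_split -prodrXl; apply: eq_bigr => e _ /=.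
by rewrite /walk; ring.
Qed.

Lemma weight_ge0 k (F : sgraph 'I_k) f : 0 <= weight F f.
Proof. by apply: prodr_ge0 => i _; apply: prodr_ge0. Qed.

Lemma walk_ge0 m a (w : 'I_m.+1 -> 'I_n) b : 0 <= walk X a w b.
Proof.
rewrite /walk !mulr_ge0 //.
by apply: prodr_ge0 => i _; apply: prodr_ge0.
Qed.

(** A map on the subdivision is a map g on the old vertices together with an
  independent family of inner vertices for each edge, and the sum over the
  latter is an entry of a power of X. *)
Lemma sum_weight_subdivision k (F : sgraph 'I_k) m (M : multigraph) :
  sgraph_iso F (subdivision m.+2 M) ->
  \sum_(f : {ffun 'I_k -> 'I_n}) weight F f =
  \sum_(g : {ffun mvertex M -> 'I_n}) \prod_e (X ^+ m.+2) (g (msrc e)) (g (mtgt e)).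
Proof.
case=> phi bphi iso; have [psi phiK psiK] := bphi.
pose glue (p : {ffun mvertex M -> 'I_n} * {ffun medge M -> {ffun 'I_m.+1 -> 'I_n}})
    (x : subdiv_vertex m.+2 M) :=
  match x with inl u => p.1 u | inr z => p.2 z.1 z.2 end.
have weightE p : weight F [ffun i => glue p (phi i)] =
    \prod_e walk X (p.1 (msrc e)) (p.2 e) (p.1 (mtgt e)).
  apply/eqP; rewrite -(@eqrXn2 _ 2) ?weight_ge0 //; last first.
    by apply: prodr_ge0 => e _; exact: walk_ge0.
  rewrite -weight2E; have := weight2_iso (glue p) bphi iso.
  rewrite weight2_subdivision /= => ->; apply/eqP.
  by apply: eq_bigr => x _; apply: eq_bigr => y _; rewrite !ffunE.
rewrite (reindex (fun p => [ffun i => glue p (phi i)])) /=; last first.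
  exists (fun f : {ffun 'I_k -> 'I_n} => ([ffun u => f (psi (inl u))],
    [ffun e => [ffun i => f (psi (inr (e, i)))]])) => [[g h] _|f _].
    congr (_, _); apply/ffunP => u; rewrite !ffunE ?psiK //.
    by apply/ffunP => i; rewrite !ffunE psiK.
  apply/ffunP => i; rewrite !ffunE -[in RHS](phiK i).
  by case: (phi i) => [u|[e j]] /=; rewrite !ffunE.
under eq_bigr do rewrite weightE.
rewrite -(pair_bigA _ (fun (g : {ffun mvertex M -> 'I_n})
  (h : {ffun medge M -> {ffun 'I_m.+1 -> 'I_n}}) => \prod_e walk X (g (msrc e)) (h e) (g (mtgt e)))) /=.
apply: eq_bigr => g _; under [RHS]eq_bigr do rewrite -sum_walk.
by rewrite bigA_distr_bigA.
Qed.

End Weights.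
(** * Homomorphism densities of subdivisions, stars and even cycles *)

Section Densities.
Variable R : realFieldType.

Definition hom_density k (F : sgraph 'I_k) n (X : 'M[R]_n) : R :=
  n%:R ^- k * \sum_(f : {ffun 'I_k -> 'I_n}) weight X F f.

Lemma card_edges k (F : sgraph 'I_k) :
  #|edges F| = (\sum_(i < k) \sum_(j < k | (i < j)%N && adj F i j) 1)%N.
Proof.
pose ordered := [set p : 'I_k * 'I_k | (p.1 < p.2)%N && adj F p.1 p.2]%SET.
have -> : edges F = [set [set p.1; p.2] | p in ordered]%SET.
  apply/setP => e; rewrite inE; apply/existsP/imsetP => [[x /existsP[y /andP[xy /eqP ->]]]|].
    have [lt|lt|/val_inj E] := ltngtP x y; last by rewrite E (adj_irr F) in xy.
      by exists (x, y); rewrite ?inE //= lt.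
    by exists (y, x); rewrite ?inE /= ?lt 1?(adj_sym F) // finset.setUC.
  case=> -[x y]; rewrite inE /= => /andP[_ xy] ->.
  by exists x; apply/existsP; exists y; rewrite xy eqxx.
rewrite card_in_imset => [|[x y] [x' y']]; last first.
  rewrite !inE /= => /andP[xy _] /andP[xy' _] /setP E.
  have := E x; have := E y; rewrite !inE !eqxx !orbT /=.
  move=> /esym/orP[]/eqP yE /esym/orP[]/eqP xE; subst; rewrite ?ltnn // in xy.
  by have := ltn_trans xy xy'; rewrite ltnn.
rewrite -sum1_card pair_big_dep /=.
by apply: eq_bigl => p; rewrite inE.
Qed.

Lemma weight_scale k (F : sgraph 'I_k) n (c : R) (X : 'M[R]_n) f :
  weight (c *: X) F f = c ^+ #|edges F| * weight X F f.
Proof.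
rewrite card_edges -prodrXr -big_split; apply: eq_bigr => i _ /=.
rewrite -prodrXr -big_split; apply: eq_bigr => j _ /=.
by rewrite mxE expr1.
Qed.

Definition adjacency n (G : sgraph 'I_n) : 'M[R]_n := \matrix_(i, j) (adj G i j)%:R.

Lemma hom_sum k (F : sgraph 'I_k) n (G : sgraph 'I_n) :
  (Defs.hom F G)%:R = \sum_(f : {ffun 'I_k -> 'I_n}) weight (adjacency G) F f.
Proof.
rewrite /Defs.hom -sum1_card natr_sum big_mkcond; apply: eq_bigr => f _; rewrite inE.
rewrite /weight; case: ifPn => [/forallP H|/forallPn[x /forallPn[y]]].
  rewrite big1 // => i _; rewrite big1 // => j /andP[_ ij]; rewrite mxE.
  by have /forallP/(_ j) := H i; rewrite ij /= => ->.
rewrite negb_imply => /andP[xy nG]; apply/esym/eqP.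
wlog lt : x y xy nG / (x < y)%N.
  move=> H; have [lt|lt|/val_inj E] := ltngtP x y; last by rewrite E (adj_irr F) in xy.
    exact: (H x y).
  by apply: (H y x) => //; rewrite adj_sym.
rewrite (bigD1 x) //= (bigD1 y) ?lt //= mxE (negPf nG) !mul0r //.
Qed.

Lemma tp_hom_density k (F : sgraph 'I_k) n (G : sgraph 'I_n) (p : R) :
  (Defs.hom F G)%:R / (p ^+ #|edges F| * n%:R ^+ k) =
  hom_density F (p^-1 *: adjacency G).
Proof.
rewrite /hom_density hom_sum; under [in RHS]eq_bigr do rewrite weight_scale.
by rewrite -mulr_sumr exprVn invfM; ring.
Qed.

Lemma card_subdiv k (F : sgraph 'I_k) m (M : multigraph) :
  sgraph_iso F (subdivision m.+2 M) -> k = (#|mvertex M| + #|medge M| * m.+1)%N.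
Proof.
case=> phi bphi _; have := bij_eq_card bphi.
by rewrite card_sum card_prod !card_ord.
Qed.

Lemma hom_density_subdivision k (F : sgraph 'I_k) n (X : 'M[R]_n) m M : (0 < n)%N ->
  (forall i j, 0 <= X i j) -> (forall i j, X i j = X j i) ->
  sgraph_iso F (subdivision m.+2 M) ->
  hom_density F X =
  density (@msrc M) (@mtgt M) ((n%:R^-1 *: X) ^+ m.+2).
Proof.
move=> n0 X0 sX iso; rewrite /hom_density /density (sum_weight_subdivision X0 sX iso).
have nn : n%:R != 0 :> R by rewrite pnatr_eq0 -lt0n.
rewrite (card_subdiv iso).
have -> : (n%:R^-1 *: X) ^+ m.+2 = (n%:R^-1) ^+ m.+2 *: X ^+ m.+2.
  elim: m.+2 => [|j IH]; first by rewrite !expr0 scale1r.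
  by rewrite !exprS IH -!mulmxE -scalemxAl -scalemxAr scalerA.
rewrite exprD invfM -mulrA; congr (_ * _); rewrite mulr_sumr; apply: eq_bigr => g _.
rewrite mulnC exprM -exprVn -prodr_const -big_split; apply: eq_bigr => e _ /=.
rewrite [X in _ = _ * X]mxE mulrA; congr (_ * _).
by rewrite [X in _ = _ * X]exprS mulrA divff // mul1r exprVn.
Qed.

Lemma enum_sgraph (V : finType) (F : sgraph V) :
  exists F' : sgraph 'I_#|V|, sgraph_iso F' F.
Proof.
have sym : symmetric (fun i j : 'I_#|V| => adj F (enum_val i) (enum_val j)).
  by move=> i j; exact: adj_sym.
have irr : irreflexive (fun i j : 'I_#|V| => adj F (enum_val i) (enum_val j)).
  by move=> i; exact: adj_irr.
exists (SGraph sym irr); exists enum_val => //; exact: enum_val_bij.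
Qed.

(** Its subdivisions give the moments of the kernel of a power of W. *)
Definition parallel_edges q : multigraph :=
  @Multigraph bool 'I_q (fun=> false) (fun=> true) (fun=> isT).

Lemma sum_ffun_bool n (H : 'I_n -> 'I_n -> R) :
  \sum_(g : {ffun bool -> 'I_n}) H (g false) (g true) = \sum_i \sum_j H i j.
Proof.
case: n H => [|n] H.
  by rewrite !big1 // => [[]//|g]; have [] := g true.
have n2 : n.+1%:R ^+ 2 != 0 :> R by rewrite expf_neq0 // pnatr_eq0.
by apply: (mulfI n2); rewrite (@sum_ffun_two R bool _ H false true isT) card_bool.
Qed.

Lemma density_parallel q n (X : 'M[R]_n) :
  density (@msrc (parallel_edges q)) (@mtgt (parallel_edges q)) X =
  n%:R ^- 2 * \sum_i \sum_j (n%:R * X i j) ^+ q.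
Proof.
rewrite /density card_bool /=; congr (_ * _).
rewrite -(sum_ffun_bool (fun i j => (n%:R * X i j) ^+ q)); apply: eq_bigr => g _.
by rewrite prodr_const card_ord.
Qed.

(** The edges are antiparallel, so that going around the cycle follows both
  edges from source to target. *)
Definition double_edge : multigraph :=
  @Multigraph bool bool id negb (fun b => if b is true then isT else isT).

Lemma density_double n (X : 'M[R]_n) : (0 < n)%N -> X^T = X ->
  density (@msrc double_edge) (@mtgt double_edge) X = hs X.
Proof.
move=> n0 sX; have nn : n%:R != 0 :> R by rewrite pnatr_eq0 -lt0n.
rewrite /density card_bool /= /hs.
rewrite -(sum_ffun_bool (fun i j => X i j ^+ 2)) mulr_sumr; apply: eq_bigr => g _.
rewrite (bigD1 true) //= (bigD1 false) //= big1 => [|[]//].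
have -> : X (g true) (g false) = X (g false) (g true) by rewrite -[in LHS]sX mxE.
by field.
Qed.

Lemma cycle_double m :
  sgraph_iso (cycle_graph (2 * m.+3 - 2)) (subdivision m.+2 double_edge).
Proof.
pose N := (2 * m.+3 - 2)%N.
have NE : N = (2 * m.+2)%N by rewrite /N; lia.
pose phi (i : 'I_N) : subdiv_vertex m.+2 double_edge :=
  if i == 0 :> nat then inl false
  else if (i <= m.+1)%N then inr (false, inord i.-1)
  else if i == m.+2 :> nat then inl true
  else inr (true, inord (i - m.+3)).
have phi_cases (i : 'I_N) :
  [\/ i = 0 :> nat /\ phi i = inl false,
      exists j : 'I_m.+1, i = j.+1 :> nat /\ phi i = inr (false, j),
      i = m.+2 :> nat /\ phi i = inl true |
      exists j : 'I_m.+1, i = (j + m.+3)%N :> nat /\ phi i = inr (true, j)].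
  have := ltn_ord i; rewrite {2}NE /phi => iN.
  case: eqP => [i0|i0]; first by apply: Or41.
  case: leqP => [le|lt].
    apply: Or42; exists (inord i.-1); rewrite inordK; last by lia.
    by split=> //; lia.
  case: eqP => [i2|i2]; first by apply: Or43.
  apply: Or44; exists (inord (i - m.+3)); rewrite inordK; last by lia.
  by split=> //; lia.
exists phi.
  apply: inj_card_bij; last by rewrite card_sum card_prod !card_bool !card_ord; lia.
  move=> x y; case: (phi_cases x) => [[xE ->]|[i [xE ->]]|[xE ->]|[i [xE ->]]];
    case: (phi_cases y) => [[yE ->]|[j [yE ->]]|[yE ->]|[j [yE ->]]] //=;
    move=> E; apply/val_inj; rewrite /= xE yE //; by case: E => ->.
move=> x y; have xN : (x < 2 * m.+2)%N by rewrite -NE; exact: ltn_ord.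
have yN : (y < 2 * m.+2)%N by rewrite -NE; exact: ltn_ord.
have modE (z : nat) : (z < N)%N -> (z.+1 %% N)%N = if z.+1 == (2 * m.+2)%N then 0%N else z.+1.
  by move=> zN; rewrite -NE; case: eqP => [->|ne]; [exact: modnn|rewrite modn_small //; lia].
have one : (1 == 2 * m.+2)%N = false by lia.
rewrite /= /cycle_adj -!val_eqE /= -/N !modE ?ltn_ord //.
case: (phi_cases x) => [[xE ->]|[i [xE ->]]|[xE ->]|[i [xE ->]]];
    case: (phi_cases y) => [[yE ->]|[j [yE ->]]|[yE ->]|[j [yE ->]]];
    rewrite /= ?andbF ?andbT ?orbF ?xE ?yE ?one //;
    try have := ltn_ord i; try have := ltn_ord j; do ?[case: ifP => ?]; lia.
Qed.

Definition star_adj k : rel 'I_k.+1 := fun i j => (i == ord0) != (j == ord0).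

Lemma star_adj_sym k : symmetric (@star_adj k).
Proof. by move=> i j; rewrite /star_adj eq_sym. Qed.

Lemma star_adj_irr k : irreflexive (@star_adj k).
Proof. by move=> i; rewrite /star_adj eqxx. Qed.

Definition star k : sgraph 'I_k.+1 := SGraph (@star_adj_sym k) (@star_adj_irr k).

(** Every edge contains the centre, so a cycle would visit it at every second
  step. *)
Lemma star_tree k : is_tree (star k).
Proof.
split; first by rewrite card_ord.
  have con0 (x : 'I_k.+1) : connect (adj (star k)) ord0 x.
    by have [->|x0] := eqVneq x ord0; [exact: connect0|apply: connect1; rewrite /= /star_adj eqxx (negPf x0)].
  have sym : connect_sym (adj (star k)) by apply: sym_connect_sym; exact: star_adj_sym.
  by move=> x y; apply: (connect_trans _ (con0 y)); rewrite sym.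
move=> [|a [|b [|c s]]] //= _; rewrite /ucycleb /= /star_adj.
apply/negP; rewrite !inE !negb_or => /andP[/and3P[ab bc H]].
rewrite -!andbA => /and5P[nab nac nas nbc nbs].
have [b0|b0] := eqVneq b ord0.
  rewrite b0 eqxx in ab bc.
  have c0 : c != ord0 by rewrite b0 eq_sym in nbc.
  have a0 : a != ord0 by rewrite b0 in nab.
  case: s H nas nbs => [|d s] /=; first by rewrite (negPf c0) (negPf a0).
  rewrite (negPf c0) !inE !negb_or => /andP[d0 _] _ /andP[bd _].
  by move: d0; rewrite -b0; case: (eqVneq d b) => // db; rewrite db eqxx in bd.
rewrite (negPf b0) in ab bc.
have aE : a = ord0 by move: ab; case: (eqVneq a ord0).
have cE : c = ord0 by move: bc; case: (eqVneq c ord0).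
by rewrite aE cE eqxx in nac.
Qed.

Lemma hom_density_star k n (X : 'M[R]_n) : (0 < n)%N ->
  hom_density (star k) X =
  n%:R^-1 * \sum_i (\sum_j n%:R^-1 * X i j) ^+ k.
Proof.
move=> n0; have nn : n%:R != 0 :> R by rewrite pnatr_eq0 -lt0n.
rewrite /hom_density sum_ffun_cons exprS invfM -mulrA; congr (_ * _).
rewrite mulr_sumr; apply: eq_bigr => x _.
have -> : \sum_(w : {ffun 'I_k -> 'I_n}) weight X (star k) (fcons x w) =
    \sum_(w : {ffun 'I_k -> 'I_n}) \prod_j X x (w j).
  apply: eq_bigr => w _; rewrite /weight big_ord_recl /= [X in _ * X]big1 ?mulr1.
    rewrite big_mkcond big_ord_recl /= mul1r; apply: eq_bigr => j _.
    by rewrite fcons0 fconsS.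
  by move=> i _; rewrite big1 // => j /andP[ij]; rewrite /star_adj; case: j ij => [[]].
rewrite (sum_ffun_prod (fun _ j => X x j)) prodr_const card_ord -mulr_sumr.
by rewrite exprMn exprVn.
Qed.

End Densities.
Local Open Scope classical_set_scope.

(** * Means of bounded measurable functions *)

Section BoundedMeasurable.
Variables (R : realType) (d : measure_display) (X : measurableType d).

(** On a probability space these functions are integrable and closed under the
  operations below, so that integrals can be handled as real numbers. *)
Definition bounded_meas (f : X -> R) : Prop :=
  measurable_fun setT f /\ exists B, forall x, `|f x| <= B.

Lemma bm_cst c : bounded_meas (fun=> c).
Proof. by split; [exact: measurable_cst|exists `|c|]. Qed.

Lemma bmD f g : bounded_meas f -> bounded_meas g -> bounded_meas (fun x => f x + g x).
Proof.
move=> [mf [B fB]] [mg [B' gB]]; split; first exact: measurable_funD.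
by exists (B + B') => x; rewrite (le_trans (ler_normD _ _)) // lerD.
Qed.

Lemma bmM f g : bounded_meas f -> bounded_meas g -> bounded_meas (fun x => f x * g x).
Proof.
move=> [mf [B fB]] [mg [B' gB]]; split; first exact: measurable_funM.
by exists (B * B') => x; rewrite normrM ler_pM.
Qed.

Lemma bmZ c f : bounded_meas f -> bounded_meas (fun x => c * f x).
Proof. by move=> bf; exact: (bmM (bm_cst c) bf). Qed.

Lemma bmB f g : bounded_meas f -> bounded_meas g -> bounded_meas (fun x => f x - g x).
Proof.
move=> bf bg; have := bmD bf (bmZ (-1) bg).
by under [in X in X -> _]eq_fun do rewrite mulN1r.
Qed.

Lemma bm_sum (I : Type) (r : seq I) (p : pred I) (f : I -> X -> R) :
  (forall i, bounded_meas (f i)) -> bounded_meas (fun x => \sum_(i <- r | p i) f i x).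
Proof.
move=> bf; elim: r => [|i r IH]; first by under eq_fun do rewrite big_nil; exact: bm_cst.
under eq_fun do rewrite big_cons.
by case: (p i) => //; exact: bmD.
Qed.

Lemma bm_prod (I : Type) (r : seq I) (p : pred I) (f : I -> X -> R) :
  (forall i, bounded_meas (f i)) -> bounded_meas (fun x => \prod_(i <- r | p i) f i x).
Proof.
move=> bf; elim: r => [|i r IH]; first by under eq_fun do rewrite big_nil; exact: bm_cst.
under eq_fun do rewrite big_cons.
by case: (p i) => //; exact: bmM.
Qed.

Lemma bm_indic (A : set X) : measurable A -> bounded_meas (\1_A : X -> R).
Proof.
move=> mA; split; first exact: measurable_indic.
by exists 1 => x; rewrite indicE; case: (_ \in _); rewrite ?normr1 ?normr0.
Qed.

End BoundedMeasurable.

Lemma bm_comp (R : realType) d d' (X : measurableType d) (Y : measurableType d')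
    (f : Y -> R) (g : X -> Y) : measurable_fun setT g -> bounded_meas f ->
  bounded_meas (fun x => f (g x)).
Proof.
by move=> mg [mf [B fB]]; split; [exact: measurableT_comp mf mg|exists B].
Qed.

Section Mean.
Variables (R : realType) (d : measure_display) (X : measurableType d).
Variable P : probability X R.
Local Notation mean f := (Rintegral P setT f).

Lemma bm_integrable (f : X -> R) : bounded_meas f -> P.-integrable setT (EFin \o f).
Proof.
move=> [mf [B fB]]; apply: measurable_bounded_integrable => //.
  by rewrite [X in (X < _)%E](@probability_setT _ _ _ P) ltry.
exists B; split; first exact: num_real.
by move=> z Bz x _ /=; apply: le_trans (ltW Bz).
Qed.

Lemma mean_EFin (f : X -> R) : bounded_meas f -> (mean f)%:E = (\int[P]_x (f x)%:E)%E.
Proof.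
by move=> bf; rewrite fineK //; apply: integrable_fin_num => //; exact: bm_integrable.
Qed.

Lemma eq_mean (f g : X -> R) : f =1 g -> mean f = mean g.
Proof. by move=> fg; apply: eq_Rintegral => x _; exact: fg. Qed.

Lemma meanD (f g : X -> R) : bounded_meas f -> bounded_meas g ->
  mean (fun x => f x + g x) = mean f + mean g.
Proof. by move=> bf bg; rewrite RintegralD //; exact: bm_integrable. Qed.

Lemma meanZ c (f : X -> R) : bounded_meas f -> mean (fun x => c * f x) = c * mean f.
Proof. by move=> bf; rewrite RintegralZl //; exact: bm_integrable. Qed.

Lemma meanB (f g : X -> R) : bounded_meas f -> bounded_meas g ->
  mean (fun x => f x - g x) = mean f - mean g.
Proof. by move=> bf bg; rewrite RintegralB //; exact: bm_integrable. Qed.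

Lemma mean_cst c : mean (fun=> c) = c.
Proof. by rewrite Rintegral_cst // [X in fine X](@probability_setT _ _ _ P) /= mulr1. Qed.

Lemma le_mean (f g : X -> R) : bounded_meas f -> bounded_meas g ->
  (forall x, f x <= g x) -> mean f <= mean g.
Proof. by move=> bf bg fg; apply: le_Rintegral => //; exact: bm_integrable. Qed.

Lemma mean_norm (f : X -> R) B : bounded_meas f -> (forall x, `|f x| <= B) ->
  `|mean f| <= B.
Proof.
move=> bf fB; rewrite ler_norml -{1}(mean_cst (- B)) -{2}(mean_cst B).
by rewrite !le_mean //; try exact: bm_cst; move=> x; have := fB x; rewrite ler_norml => /andP[].
Qed.

Lemma mean_sum (I : Type) (r : seq I) (p : pred I) (f : I -> X -> R) :
  (forall i, bounded_meas (f i)) ->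
  mean (fun x => \sum_(i <- r | p i) f i x) = \sum_(i <- r | p i) mean (f i).
Proof.
move=> bf; elim: r => [|i r IH].
  by rewrite big_nil -[RHS](mean_cst 0); apply: eq_mean => x; rewrite big_nil.
rewrite big_cons -IH; case: ifP => pi.
  rewrite -meanD //; last exact: bm_sum.
  by apply: eq_mean => x; rewrite big_cons pi.
by apply: eq_mean => x; rewrite big_cons pi.
Qed.

End Mean.
Notation mean P f := (Rintegral P setT f).

Section MeanFubini.
Variables (R : realType) (d d' : measure_display).
Variables (X : measurableType d) (Y : measurableType d').
Variables (P : probability X R) (Q : probability Y R).
Variable f : X * Y -> R.
Hypothesis bf : bounded_meas f.

Lemma bm_section1 x : bounded_meas (fun y => f (x, y)).
Proof. by apply: bm_comp bf; exact: pair1_measurable. Qed.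

Lemma bm_section2 y : bounded_meas (fun x => f (x, y)).
Proof. by apply: bm_comp bf; exact: pair2_measurable. Qed.

Lemma bm_mean1 : bounded_meas (fun x => mean Q (fun y => f (x, y))).
Proof.
split; last first.
  have [_ [B fB]] := bf; exists B => x.
  by apply: mean_norm => [|y]; [exact: bm_section1|exact: fB].
apply/measurable_EFinP.
rewrite [X in measurable_fun _ X](_ : _ = fubini_F Q (EFin \o f)).
  exact: measurable_fubini_F (bm_integrable (P \x Q)%E bf).
by apply/funext => x /=; rewrite mean_EFin //; exact: bm_section1.
Qed.

Lemma bm_mean2 : bounded_meas (fun y => mean P (fun x => f (x, y))).
Proof.
split; last first.
  have [_ [B fB]] := bf; exists B => x.
  by apply: mean_norm => [|y]; [exact: bm_section2|exact: fB].
apply/measurable_EFinP.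
rewrite [X in measurable_fun _ X](_ : _ = fubini_G P (EFin \o f)).
  exact: measurable_fubini_G (bm_integrable (P \x Q)%E bf).
by apply/funext => x /=; rewrite mean_EFin //; exact: bm_section2.
Qed.

Lemma mean_fubini1 : mean (P \x Q)%E f = mean P (fun x => mean Q (fun y => f (x, y))).
Proof.
apply: EFin_inj; rewrite (mean_EFin (P \x Q)%E bf) (mean_EFin P bm_mean1).
rewrite -(integral12_prod_meas1 (bm_integrable (P \x Q)%E bf)).
apply: eq_integral => x _; rewrite mean_EFin //; exact: bm_section1.
Qed.

Lemma mean_fubini2 : mean (P \x Q)%E f = mean Q (fun y => mean P (fun x => f (x, y))).
Proof.
apply: EFin_inj; rewrite (mean_EFin (P \x Q)%E bf) (mean_EFin Q bm_mean2).
rewrite -(integral21_prod_meas1 (bm_integrable (P \x Q)%E bf)).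
apply: eq_integral => x _; rewrite mean_EFin //; exact: bm_section2.
Qed.

Lemma mean_swap : mean P (fun x => mean Q (fun y => f (x, y))) =
  mean Q (fun y => mean P (fun x => f (x, y))).
Proof. by rewrite -mean_fubini1 mean_fubini2. Qed.

End MeanFubini.

Lemma mean_pushforward (R : realType) d d' (X : measurableType d) (Y : measurableType d')
    (P : probability X R) (phi : X -> Y) (f : Y -> R) :
  measurable_fun setT phi -> bounded_meas f ->
  fine (\int[pushforward P phi]_y (f y)%:E)%E = mean P (fun x => f (phi x)).
Proof.
move=> mphi bf; rewrite integral_pushforward //.
  by apply/measurable_EFinP; case: bf.
exact: (bm_integrable P (bm_comp mphi bf)).
Qed.
(** * Lebesgue measure on the cube *)

Section Cube.
Variable R : realType.
Local Notation T := (measurableTypeR R).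
Local Notation lam := (@lebesgue01 R).
Local Notation cubeP k := (@lebesgue_cube R k).

Lemma measurable_coord k (i : 'I_k) :
  measurable_fun setT ((fun x => tnth x i) : k.-tuple T -> T).
Proof. exact: measurable_tnth. Qed.

Lemma mean_cube_cons k (H : k.+1.-tuple T -> R) : bounded_meas H ->
  mean (cubeP k.+1) H = mean lam (fun x => mean (cubeP k) (fun y => H [tuple of x :: y])).
Proof.
move=> bH; rewrite /= /Rintegral /distribution.
have mc := @measurable_cons_pair R k.
rewrite (mean_pushforward (lam \x cubeP k)%E mc bH).
exact: (mean_fubini1 lam (cubeP k) (bm_comp mc bH)).
Qed.

Definition set_coord k (x : k.-tuple T) (i : 'I_k) (t : T) : k.-tuple T :=
  [tuple if j == i then t else tnth x j | j < k].

Lemma tnth_set_coord k (x : k.-tuple T) i t j :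
  tnth (set_coord x i t) j = if j == i then t else tnth x j.
Proof. by rewrite tnth_mktuple. Qed.

Lemma measurable_set_coord k (i : 'I_k) :
  measurable_fun setT (fun z : k.-tuple T * T => set_coord z.1 i z.2).
Proof.
apply/measurable_fun_tnthP => j.
rewrite (_ : _ \o _ = fun z : k.-tuple T * T => if j == i then z.2 else tnth z.1 j).
  case: (j == i); first exact: measurable_snd.
  exact: ((measurable_fun_tnthP _).1 measurable_fst j).
by apply/funext => z /=; rewrite tnth_set_coord.
Qed.

Lemma set_coord_head k x0 (x : k.-tuple T) t :
  set_coord [tuple of x0 :: x] ord0 t = [tuple of t :: x].
Proof.
apply: eq_from_tnth => j; rewrite tnth_set_coord.
by case: (unliftP ord0 j) => [j' ->|->] //=; rewrite !tnthS.
Qed.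

Lemma set_coord_behead k x0 (x : k.-tuple T) i t :
  set_coord [tuple of x0 :: x] (lift ord0 i) t = [tuple of x0 :: set_coord x i t].
Proof.
apply: eq_from_tnth => j; rewrite tnth_set_coord.
case: (unliftP ord0 j) => [j' ->|->] //=.
by rewrite !tnthS tnth_set_coord (inj_eq lift_inj).
Qed.

(** The coordinates are independent, so redrawing one of them preserves the law.
  This isolates a coordinate without permuting the others. *)
Lemma mean_resample k (H : k.-tuple T -> R) (i : 'I_k) : bounded_meas H ->
  mean (cubeP k) H = mean (cubeP k) (fun x => mean lam (fun t => H (set_coord x i t))).
Proof.
elim: k H i => [|k IH] H i bH; first by case: i.
have bS := bm_comp (measurable_set_coord i) bH.
rewrite mean_cube_cons // (mean_cube_cons (bm_mean1 (cubeP k.+1) lam bS)).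
case: (unliftP ord0 i) bS => [j ->|->] bS /=.
  apply: eq_mean => x0; rewrite (IH _ j); last first.
    apply: (bm_comp _ bH); apply: measurable_cons => //; exact: measurable_cst.
  by apply: eq_mean => x; apply: eq_mean => t; rewrite set_coord_behead.
have bc : bounded_meas (fun z : T * k.-tuple T => H [tuple of z.1 :: z.2]).
  exact: (bm_comp (@measurable_cons_pair R k) bH).
rewrite -[LHS](mean_cst lam); apply: eq_mean => x0.
rewrite (mean_swap lam (cubeP k) bc); apply: eq_mean => x.
by apply: eq_mean => t; rewrite set_coord_head.
Qed.

Lemma measurable_map_tuple k (tau : T -> T) : measurable_fun setT tau ->
  measurable_fun setT (fun x : k.-tuple T => [tuple of map tau x]).
Proof.
move=> mt; apply/measurable_fun_tnthP => j.
rewrite (_ : _ \o _ = fun x : k.-tuple T => tau (tnth x j)).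
  by apply: (measurableT_comp mt); exact: measurable_coord.
by apply/funext => z /=; rewrite tnth_map.
Qed.

Lemma mean_cube_map k (tau : T -> T) (H : k.-tuple T -> R) :
  measurable_fun setT tau ->
  (forall f, bounded_meas f -> mean lam (fun x => f (tau x)) = mean lam f) ->
  bounded_meas H ->
  mean (cubeP k) (fun x => H [tuple of map tau x]) = mean (cubeP k) H.
Proof.
move=> mt inv; elim: k H => [|k IH] H bH.
  by apply: eq_mean => x; congr H; apply: eq_from_tnth; case.
have bc : bounded_meas (fun z : T * k.-tuple T => H [tuple of z.1 :: z.2]).
  exact: (bm_comp (@measurable_cons_pair R k) bH).
rewrite (mean_cube_cons (bm_comp (measurable_map_tuple mt) bH)) (mean_cube_cons bH).
rewrite -[RHS](inv _ (bm_mean1 lam (cubeP k) bc)).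
apply: eq_mean => x0 /=.
rewrite -(IH (fun x => H [tuple of tau x0 :: x]) (bm_section1 bc (tau x0))).
by apply: eq_mean => x; congr H; apply: eq_from_tnth => j; rewrite !(tnth_nth x0).
Qed.

(** A function of coordinates that take finitely many values, uniformly when c is
  the inverse of their number, has as mean the mean of a function on functions.
  It links integrals over the cube to sums over maps between vertices. *)
Lemma mean_cube_finite k (I : finType) (phi : T -> I) (c : R)
    (H : {ffun 'I_k -> I} -> R) :
  (forall i, measurable (phi @^-1` [set i])) ->
  (forall f : I -> R, mean lam (fun x => f (phi x)) = c * \sum_i f i) ->
  mean (cubeP k) (fun x => H [ffun i => phi (tnth x i)]) = c ^+ k * \sum_f H f.
Proof.
move=> mphi unif.
have bphi f : bounded_meas (fun x => f (phi x) : R).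
  have -> : (fun x => f (phi x)) = fun x => \sum_i f i * \1_(phi @^-1` [set i]) x.
    apply/funext => x; rewrite (bigD1 (phi x)) //= indicE mem_set // mulr1.
    by rewrite big1 ?addr0 // => i /eqP ne; rewrite indicE memNset ?mulr0 //= => /esym.
  by apply: bm_sum => i; apply: bmZ; exact: bm_indic.
have bH j (G : {ffun 'I_j -> I} -> R) :
    bounded_meas (fun x : j.-tuple T => G [ffun i => phi (tnth x i)]).
  have -> : (fun x : j.-tuple T => G [ffun i => phi (tnth x i)]) =
     fun x => \sum_f G f * \prod_i (phi (tnth x i) == f i)%:R.
    apply/funext => x; rewrite (bigD1 [ffun i => phi (tnth x i)]) //=.
    rewrite [X in _ * X]big1 ?mulr1; last by move=> i _; rewrite ffunE eqxx.
    rewrite big1 ?addr0 // => f /eqP ne.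
    case: (pickP (fun i => phi (tnth x i) != f i)) => [i /negPf ni|eqf].
      by rewrite (bigD1 i) //= ni mul0r mulr0.
    by case: ne; apply/ffunP => i; rewrite ffunE; have /negbFE/eqP -> := eqf i.
  apply: bm_sum => f; apply: bmZ; apply: bm_prod => i.
  exact: (bm_comp (measurable_coord i) (bphi (fun y => (y == f i)%:R))).
elim: k H => [|k IH] H.
  rewrite expr0 mul1r (big_pred1 [ffun i => phi (tnth [tuple] i)]); last first.
    by move=> f; apply/esym/eqP/ffunP => -[].
  rewrite -[RHS](mean_cst (cubeP 0)); apply: eq_mean => x.
  by congr H; apply/ffunP => -[].
rewrite mean_cube_cons //.
have fE x0 (x : k.-tuple T) : [ffun i => phi (tnth [tuple of x0 :: x] i)] =
    fcons (phi x0) [ffun i => phi (tnth x i)].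
  apply/ffunP => i; case: (unliftP ord0 i) => [j ->|->].
    by rewrite fconsS !ffunE tnthS.
  by rewrite fcons0 !ffunE.
rewrite (@eq_mean _ _ _ lam _ (fun x0 => c ^+ k * \sum_w H (fcons (phi x0) w))); last first.
  move=> x0; rewrite -(IH (fun w => H (fcons (phi x0) w))).
  by apply: eq_mean => x; rewrite fE.
rewrite meanZ; last exact: (bphi (fun z => \sum_w H (fcons z w))).
by rewrite (unif (fun z => \sum_w H (fcons z w))) sum_ffun_cons exprS mulrCA mulrA.
Qed.

Lemma measurable_cube k : measurable (@cube R k).
Proof.
rewrite (_ : @cube R k = \big[setI/setT]_(i < k) ((fun x => tnth x i) @^-1` @unit_itv R)).
  apply: bigsetI_measurable => i _.
  by rewrite -[X in measurable X]setTI; apply: measurable_tnth => //; exact: measurable_unit_itv.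
rewrite -bigcap_seq; apply/seteqP; split => x /=; first by move=> xc i _; exact: xc.
by move=> xc i; apply: xc; rewrite /= mem_index_enum.
Qed.

Lemma mean_cube k : mean (cubeP k) (\1_(@cube R k)) = 1.
Proof.
have bc j : bounded_meas (\1_(@cube R j) : j.-tuple T -> R).
  by apply: bm_indic; exact: measurable_cube.
elim: k => [|k IH].
  rewrite -[RHS](mean_cst (cubeP 0)); apply: eq_mean => x.
  by rewrite indicE mem_set // => -[].
rewrite (mean_cube_cons (bc k.+1)).
rewrite (@eq_mean _ _ _ lam _ (fun x0 => \1_(@unit_itv R) x0)); last first.
  move=> x0; rewrite (@eq_mean _ _ _ (cubeP k) _ (fun x => \1_(@unit_itv R) x0 * \1_(@cube R k) x)).
    by rewrite (meanZ (cubeP k) _ (bc k)) IH mulr1.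
  move=> x; rewrite !indicE -natrM mulnb; congr (nat_of_bool _)%:R.
  apply/idP/andP; rewrite !inE.
    move=> xc; split; first exact: (xc ord0).
    by move=> i; have := xc (lift ord0 i); rewrite tnthS.
  move=> -[u xc] i; case: (unliftP ord0 i) => [j ->|->] //=.
  by rewrite tnthS; exact: xc.
have bi : bounded_meas (\1_(@unit_itv R) : T -> R).
  by apply: bm_indic; exact: measurable_unit_itv.
apply: EFin_inj; rewrite (mean_EFin lam bi).
rewrite integral_indic //; last exact: measurable_unit_itv.
rewrite setIT; transitivity (lebesgue_measure (@unit_itv R `&` @unit_itv R)) => //.
by rewrite setIid lebesgue_measure_itv /= lte_fin ltr01 oppr0 adde0.
Qed.

End Cube.
(** * Bilinear forms and the counting lemma *)

Section CutForms.
Variable R : realType.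
Local Notation T := (measurableTypeR R).
Local Notation lam := (@lebesgue01 R).
Local Notation cubeP k := (@lebesgue_cube R k).

Definition cut_form (D : T -> T -> R) (a b : T -> R) : R :=
  mean lam (fun x => mean lam (fun y => D x y * (a x * b y))).

Lemma bm_cut_form (D : T -> T -> R) (a b : T -> R) :
  bounded_meas (fun z : T * T => D z.1 z.2) -> bounded_meas a -> bounded_meas b ->
  bounded_meas (fun z : T * T => D z.1 z.2 * (a z.1 * b z.2)).
Proof.
move=> bD ba bb; apply: bmM => //.
by apply: bmM; [exact: (bm_comp measurable_fst ba)|exact: (bm_comp measurable_snd bb)].
Qed.

Lemma cut_formE1 (D : T -> T -> R) (a b : T -> R) :
  bounded_meas (fun z : T * T => D z.1 z.2) -> bounded_meas b ->
  cut_form D a b = mean lam (fun x => mean lam (fun y => D x y * b y) * a x).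
Proof.
move=> bD bb; apply: eq_mean => x; rewrite mulrC -meanZ; last first.
  by apply: bmM => //; exact: (bm_section1 bD x).
by apply: eq_mean => y; rewrite mulrCA.
Qed.

Lemma cut_formE2 (D : T -> T -> R) (a b : T -> R) :
  bounded_meas (fun z : T * T => D z.1 z.2) -> bounded_meas a -> bounded_meas b ->
  cut_form D a b = mean lam (fun y => mean lam (fun x => D x y * a x) * b y).
Proof.
move=> bD ba bb; rewrite /cut_form (mean_swap lam lam (bm_cut_form bD ba bb)).
apply: eq_mean => y; rewrite mulrC -meanZ; last first.
  by apply: bmM => //; exact: (bm_section2 bD y).
by apply: eq_mean => x /=; ring.
Qed.

Definition weightfun (A : R) (a : T -> R) : Prop :=
  measurable_fun setT a /\ forall x, 0 <= a x <= A.

Lemma weightfun_bm A a : weightfun A a -> bounded_meas a.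
Proof.
by move=> [ma aA]; split => //; exists A => x; have /andP[a0 ?] := aA x; rewrite ger0_norm.
Qed.

(** The best choice of a is A times the indicator of the set where phi is
  nonnegative. *)
Lemma mean_weight_le (phi a : T -> R) (A d : R) :
  bounded_meas phi -> weightfun A a ->
  (forall S : set T, measurable S -> mean lam (fun x => phi x * \1_S x) <= d) ->
  mean lam (fun x => phi x * a x) <= A * d.
Proof.
move=> bphi wa Hd; have [ma aA] := wa.
have A0 : 0 <= A by have /andP[h1 h2] := aA 0; exact: le_trans h2.
have mS : measurable [set x | 0 <= phi x].
  have [mphi _] := bphi.
  rewrite (_ : [set x | 0 <= phi x] = setT `&` phi @^-1` `[0, +oo[%classic); last first.
    by rewrite setTI; apply/seteqP; split => x /=; rewrite in_itv /= andbT.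
  by apply: mphi => //; exact: measurable_itv.
have b1 := bmM bphi (bm_indic R mS).
apply: (@le_trans _ _ (mean lam (fun x => A * (phi x * \1_[set x | 0 <= phi x] x)))).
  apply: le_mean => [||x].
  - exact: (bmM bphi (weightfun_bm wa)).
  - exact: bmZ b1.
  have /andP[a0 a1] := aA x; rewrite indicE; case: (lerP 0 (phi x)) => h.
    by rewrite mem_set // mulr1 mulrC ler_wpM2r.
  rewrite memNset /=; last by apply/negP; rewrite -ltNge.
  by rewrite !mulr0 mulr_le0_ge0 // ltW.
by rewrite (meanZ lam A b1) ler_wpM2l // Hd.
Qed.

(** A form is linear in each argument, so [mean_weight_le] passes from sets to
  functions in one argument after the other. *)
Lemma form_weight_le (D : T -> T -> R) (d A : R) (a b : T -> R) :
  bounded_meas (fun z : T * T => D z.1 z.2) ->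
  (forall S S' : set T, measurable S -> measurable S' -> cut_form D \1_S \1_S' <= d) ->
  weightfun A a -> weightfun A b -> cut_form D a b <= A ^+ 2 * d.
Proof.
move=> bD Hd wa wb; have ba := weightfun_bm wa; have bb := weightfun_bm wb.
have step S' : measurable S' -> cut_form D a \1_S' <= A * d.
  move=> mS'; have bS' := @bm_indic R _ T _ mS'.
  rewrite cut_formE1 //; apply: mean_weight_le => // [|S mS].
    have b1 : bounded_meas (fun z : T * T => D z.1 z.2 * \1_S' z.2).
      by apply: bmM => //; exact: (bm_comp measurable_snd bS').
    exact: (bm_mean1 lam lam b1).
  by rewrite -cut_formE1 //; exact: Hd.
rewrite expr2 -mulrA cut_formE2 //; apply: mean_weight_le => // [|S mS].
  have b1 : bounded_meas (fun z : T * T => D z.1 z.2 * a z.1).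
    by apply: bmM => //; exact: (bm_comp measurable_fst ba).
  exact: (bm_mean2 lam lam b1).
by rewrite -cut_formE2 //; [exact: step|exact: bm_indic].
Qed.

Lemma cut_formB (K1 K2 : T -> T -> R) (a b : T -> R) :
  bounded_meas (fun z : T * T => K1 z.1 z.2) ->
  bounded_meas (fun z : T * T => K2 z.1 z.2) ->
  bounded_meas a -> bounded_meas b ->
  cut_form (fun x y => K1 x y - K2 x y) a b = cut_form K1 a b - cut_form K2 a b.
Proof.
move=> b1 b2 ba bb.
have c1 := bm_cut_form b1 ba bb; have c2 := bm_cut_form b2 ba bb.
rewrite /cut_form -(meanB _ (bm_mean1 lam lam c1) (bm_mean1 lam lam c2)).
apply: eq_mean => x /=; rewrite -(meanB _ (bm_section1 c1 x) (bm_section1 c2 x)).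
by apply: eq_mean => y /=; rewrite mulrBl.
Qed.

Lemma form_weight_norm (K1 K2 : T -> T -> R) (d A : R) (a b : T -> R) :
  bounded_meas (fun z : T * T => K1 z.1 z.2) ->
  bounded_meas (fun z : T * T => K2 z.1 z.2) ->
  (forall S S' : set T, measurable S -> measurable S' ->
     `|cut_form K1 \1_S \1_S' - cut_form K2 \1_S \1_S'| <= d) ->
  weightfun A a -> weightfun A b -> `|cut_form K1 a b - cut_form K2 a b| <= A ^+ 2 * d.
Proof.
move=> b1 b2 Hd wa wb; have ba := weightfun_bm wa; have bb := weightfun_bm wb.
have one (K K' : T -> T -> R) : bounded_meas (fun z : T * T => K z.1 z.2) ->
    bounded_meas (fun z : T * T => K' z.1 z.2) ->
    (forall S S' : set T, measurable S -> measurable S' ->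
       cut_form K \1_S \1_S' - cut_form K' \1_S \1_S' <= d) ->
    cut_form K a b - cut_form K' a b <= A ^+ 2 * d.
  move=> bK bK' H; rewrite -cut_formB //; apply: form_weight_le => //; first exact: bmB.
  move=> S S' mS mS'; rewrite cut_formB //; [exact: H|exact: bm_indic|exact: bm_indic].
rewrite ler_norml lerNl opprB; apply/andP; split; apply: one => // S S' mS mS'.
  by rewrite (le_trans (ler_norm _)) // distrC Hd.
by rewrite (le_trans (ler_norm _)) // Hd.
Qed.

Section Counting.
Variables (k : nat) (C d : R) (K1 K2 : T -> T -> R).
Hypothesis C1 : 1 <= C.
Hypotheses (m1 : measurable_fun setT (fun z : T * T => K1 z.1 z.2))
  (m2 : measurable_fun setT (fun z : T * T => K2 z.1 z.2)).
Hypotheses (K1C : forall x y, 0 <= K1 x y <= C) (K2C : forall x y, 0 <= K2 x y <= C).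
Hypothesis close : forall A a b, weightfun A a -> weightfun A b ->
  `|cut_form K1 a b - cut_form K2 a b| <= A ^+ 2 * d.

Let C0 : 0 <= C. Proof. exact: le_trans C1. Qed.
Let b1 : bounded_meas (fun z : T * T => K1 z.1 z.2).
Proof. by split=> //; exists C => z; have /andP[h ?] := K1C z.1 z.2; rewrite ger0_norm. Qed.
Let b2 : bounded_meas (fun z : T * T => K2 z.1 z.2).
Proof. by split=> //; exists C => z; have /andP[h ?] := K2C z.1 z.2; rewrite ger0_norm. Qed.

Let choice (e : bool) x y := if e then K1 x y else K2 x y.
Let choiceC e x y : 0 <= choice e x y <= C. Proof. by case: e. Qed.

Let value (x : k.-tuple T) (z : 'I_k * 'I_k * bool) : R :=
  choice z.2 (tnth x z.1.1) (tnth x z.1.2).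

Let bm_value z : bounded_meas (fun x => value x z).
Proof.
case: z => [[i j] e].
have mij : measurable_fun setT (fun x : k.-tuple T => (tnth x i, tnth x j)).
  by apply/measurable_fun_pairP; split; exact: measurable_coord.
by case: e; [exact: (bm_comp mij b1)|exact: (bm_comp mij b2)].
Qed.

Let prod_value_le (P : pred ('I_k * 'I_k * bool)) (r : seq ('I_k * 'I_k * bool)) x :
  0 <= \prod_(z <- r | P z) value x z <= C ^+ size r.
Proof.
elim: r => [|z r IH]; first by rewrite big_nil expr0 ler01 lexx.
rewrite big_cons /= exprS; have /andP[v0 v1] := choiceC z.2 (tnth x z.1.1) (tnth x z.1.2).
case/andP: IH => p0 p1; case: (P z); first by rewrite mulr_ge0 // ler_pM.
by rewrite p0 (le_trans p1) // ler_peMl // exprn_ge0.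
Qed.

(** With all coordinates but i and j fixed, no other edge contains both i and j,
  so the product of the other factors is a function of coordinate i times a
  function of coordinate j, and the integral is a form. *)
Lemma one_edge (i j : 'I_k) (r : seq ('I_k * 'I_k * bool)) : (i < j)%N ->
  (forall z, z \in r -> (z.1.1 < z.1.2)%N /\ z.1 != (i, j)) ->
  `|mean (cubeP k) (fun x => (K1 (tnth x i) (tnth x j) - K2 (tnth x i) (tnth x j)) *
       \prod_(z <- r) value x z)| <= (C ^+ size r) ^+ 2 * d.
Proof.
move=> ij rP; pose D x y := K1 x y - K2 x y.
have bD : bounded_meas (fun z : T * T => D z.1 z.2) by exact: bmB.
pose H (x : k.-tuple T) := D (tnth x i) (tnth x j) * \prod_(z <- r) value x z.
have ji : (j == i) = false by rewrite -val_eqE gtn_eqF.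
have bH : bounded_meas H.
  apply: bmM; last by apply: bm_prod => z; exact: bm_value.
  have mij : measurable_fun setT (fun x : k.-tuple T => (tnth x i, tnth x j)).
    by apply/measurable_fun_pairP; split; exact: measurable_coord.
  exact: (bm_comp mij bD).
have bHi := bm_comp (measurable_set_coord i) bH.
have bG := bm_mean1 (cubeP k) lam bHi.
have bGj := bm_comp (measurable_set_coord j) bG.
have -> : mean (cubeP k) H = mean (cubeP k) (fun x => mean lam (fun t => mean lam (fun s =>
    H (set_coord (set_coord x j t) i s)))).
  by rewrite (mean_resample i bH) (mean_resample j bG).
apply: mean_norm; first exact: (bm_mean1 (cubeP k) lam bGj).
move=> x.
pose a s := \prod_(z <- r | (z.1.1 != j) && (z.1.2 != j)) value (set_coord x i s) z.
pose b t := \prod_(z <- r | ~~ ((z.1.1 != j) && (z.1.2 != j))) value (set_coord x j t) z.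
have wab (l : 'I_k) (P : pred ('I_k * 'I_k * bool)) :
    weightfun (C ^+ size r) (fun s => \prod_(z <- r | P z) value (set_coord x l s) z).
  split; last by move=> s; exact: prod_value_le.
  have bs : bounded_meas (fun y => \prod_(z <- r | P z) value y z).
    by apply: bm_prod => z; exact: bm_value.
  by have [] := bm_section1 (bm_comp (measurable_set_coord l) bs) x.
have Hab s t : H (set_coord (set_coord x j t) i s) = D s t * (a s * b t).
  rewrite /H !tnth_set_coord !eqxx ji; congr (_ * _).
  rewrite (bigID (fun z : 'I_k * 'I_k * bool => (z.1.1 != j) && (z.1.2 != j))) /=.
  congr (_ * _); rewrite [LHS]big_seq_cond [RHS]big_seq_cond; apply: eq_bigr => z.
    by case/and3P => _ /negPf z1 /negPf z2; rewrite /value !tnth_set_coord z1 z2.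
  case/andP => /rP[z12 zij] zj; rewrite /value !tnth_set_coord.
  have [z1i|z1i] := eqVneq z.1.1 i.
    have z2j : z.1.2 = j by move: zj; rewrite z1i [i == j]eq_sym ji /= negbK => /eqP.
    by rewrite (surjective_pairing z.1) z1i z2j eqxx in zij.
  have [z2i|//] := eqVneq z.1.2 i.
  move: zj z12; rewrite z2i [i == j]eq_sym ji andbT negbK => /eqP ->.
  by rewrite ltnNge ltnW.
have wa : weightfun (C ^+ size r) a by exact: (wab i).
have wb : weightfun (C ^+ size r) b by exact: (wab j).
rewrite (_ : mean lam _ = cut_form K1 a b - cut_form K2 a b); first exact: (close wa wb).
have ba := weightfun_bm wa; have bb := weightfun_bm wb.
rewrite -(cut_formB b1 b2 ba bb) /cut_form (mean_swap lam lam (bm_cut_form bD ba bb)).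
by apply: eq_mean => t; apply: eq_mean => s; rewrite Hab.
Qed.

Let hybrid (r1 r2 : seq ('I_k * 'I_k)) := mean (cubeP k) (fun x =>
  \prod_(q <- r1) K1 (tnth x q.1) (tnth x q.2) * \prod_(q <- r2) K2 (tnth x q.1) (tnth x q.2)).

(** The pairs of r1 already carry K1; those of r2 are converted from K2 to K1 one
  by one, and the flag of [choice] records which kernel a pair carries. *)
Lemma hybrid_le (r1 r2 : seq ('I_k * 'I_k)) : uniq (r1 ++ r2) ->
  (forall q, q \in r1 ++ r2 -> (q.1 < q.2)%N) ->
  `|hybrid (r1 ++ r2) [::] - hybrid r1 r2| <=
     (size r2)%:R * ((C ^+ size (r1 ++ r2)) ^+ 2 * d).
Proof.
elim: r2 r1 => [|q r2 IH] r1 ur rP; first by rewrite cats0 subrr normr0 mul0r.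
rewrite -cat_rcons in ur rP *.
apply: (le_trans (ler_distD (hybrid (rcons r1 q) r2) _ _)).
rewrite /= -natr1 addrC mulrDl mul1r addrC; apply: lerD; first exact: IH.
pose tagged := [seq (p, true) | p <- r1] ++ [seq (p, false) | p <- r2].
have tE x : \prod_(z <- tagged) value x z =
    \prod_(q <- r1) K1 (tnth x q.1) (tnth x q.2) *
    \prod_(q <- r2) K2 (tnth x q.1) (tnth x q.2).
  by rewrite big_cat !big_map.
have bh (r1' r2' : seq ('I_k * 'I_k)) : bounded_meas (fun x : k.-tuple T =>
    \prod_(q <- r1') K1 (tnth x q.1) (tnth x q.2) *
    \prod_(q <- r2') K2 (tnth x q.1) (tnth x q.2)).
  by apply: bmM; apply: bm_prod => p; [exact: (bm_value (p, true))|exact: (bm_value (p, false))].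
have dpos : 0 <= d.
  have w0 : weightfun 1 (fun=> 1) by split=> // x; rewrite ler01 lexx.
  by have := close w0 w0; rewrite expr1n mul1r; exact: le_trans.
have qlt : (q.1 < q.2)%N by apply: rP; rewrite mem_cat mem_rcons mem_head.
have tP z : z \in tagged -> (z.1.1 < z.1.2)%N /\ z.1 != (q.1, q.2).
  have ne p : p \in r1 ++ r2 -> p != q.
    move=> pr; apply/eqP => pq; move: ur pr.
    by rewrite cat_rcons -cat1s uniq_catCA /= pq => /andP[/negPf ->].
  have lt p : p \in r1 ++ r2 -> (p.1 < p.2)%N.
    rewrite mem_cat => pr; apply: rP; rewrite mem_cat mem_rcons inE.
    by case/orP: pr => ->; rewrite ?orbT.
  rewrite -surjective_pairing mem_cat => /orP[] /mapP[p pr ->] /=.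
    by split; [apply: lt|apply: ne]; rewrite mem_cat pr.
  by split; [apply: lt|apply: ne]; rewrite mem_cat pr orbT.
have := one_edge qlt tP.
rewrite (_ : mean _ _ = hybrid (rcons r1 q) r2 - hybrid r1 (q :: r2)); last first.
  rewrite /hybrid -(meanB _ (bh _ _) (bh _ _)); apply: eq_mean => x.
  by rewrite tE -cats1 big_cat big_seq1 big_cons /=; ring.
move/le_trans; apply; rewrite ler_wpM2r // lerXn2r ?nnegrE ?exprn_ge0 //.
apply: ler_weXn2l => //.
by rewrite /tagged !size_cat !size_map size_rcons leq_add2r.
Qed.

Definition cube_density (F : sgraph 'I_k) (K : T -> T -> R) : R :=
  mean (cubeP k) (fun x =>
    \prod_(i < k) \prod_(j < k | (i < j)%N && adj F i j) K (tnth x i) (tnth x j)).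

Lemma counting_lemma (F : sgraph 'I_k) :
  `|cube_density F K1 - cube_density F K2| <= #|edges F|%:R * ((C ^+ #|edges F|) ^+ 2 * d).
Proof.
pose r : seq ('I_k * 'I_k) := [seq q : 'I_k * 'I_k <- index_enum _ | (q.1 < q.2)%N && adj F q.1 q.2].
have rE : #|edges F| = size r.
  by rewrite card_edges pair_big_dep sum1_count /r size_filter.
have := @hybrid_le [::] r; rewrite /= -rE.
have -> : hybrid r [::] = cube_density F K1.
  apply: eq_mean => x; rewrite big_nil mulr1 pair_big_dep /= big_filter.
  by apply: eq_bigl => q.
have -> : hybrid [::] r = cube_density F K2.
  apply: eq_mean => x; rewrite big_nil mul1r pair_big_dep /= big_filter.
  by apply: eq_bigl => q.
apply; first by rewrite filter_uniq // index_enum_uniq.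
by move=> q; rewrite mem_filter => /andP[/andP[]].
Qed.

End Counting.
End CutForms.
(** * Functions that are constant on cells of the unit interval *)

Section UnitInterval.
Variable R : realType.
Local Notation T := (measurableTypeR R).
Local Notation lam := (@lebesgue01 R).
Local Notation leb := (@lebesgue_measure R).

(** The complement of I is a null set and f is bounded. *)
Lemma mean_full d (X : measurableType d) (P : probability X R) (I : set X) (f : X -> R) :
  measurable I -> mean P \1_I = 1 -> bounded_meas f ->
  mean P (fun x => f x * \1_I x) = mean P f.
Proof.
move=> mI PI bf; have bI := bm_indic R mI; have [_ [B fB]] := bf.
have b1 : bounded_meas (fun x => 1 - \1_I x : R) by exact: bmB (bm_cst _ 1) bI.
have b2 : bounded_meas (fun x => f x * (1 - \1_I x)) by exact: bmM.
have I01 x : 0 <= 1 - \1_I x :> R.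
  by rewrite indicE; case: (x \in I); rewrite ?subrr ?subr0.
have null : mean P (fun x => B * (1 - \1_I x)) = 0.
  by rewrite meanZ // (meanB P (bm_cst _ 1) bI) mean_cst PI subrr mulr0.
have -> : mean P f = mean P (fun x => f x * \1_I x) + mean P (fun x => f x * (1 - \1_I x)).
  rewrite -meanD //; last exact: bmM.
  by apply: eq_mean => x; rewrite -mulrDr addrC subrK mulr1.
suff -> : mean P (fun x => f x * (1 - \1_I x)) = 0 by rewrite addr0.
apply/eqP; rewrite eq_le; apply/andP; split.
  rewrite -null; apply: le_mean => //; first exact: bmZ.
  by move=> x; rewrite ler_wpM2r // (le_trans (ler_norm _)).
rewrite -[leLHS]oppr0 -null -mulN1r -meanZ; last exact: bmZ.
apply: le_mean => //; first exact/bmZ/bmZ.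
move=> x; rewrite mulN1r -mulNr ler_wpM2r //.
by rewrite lerNl (le_trans (ler_norm _)) // normrN.
Qed.

Lemma lebesgue01E (A : set T) : lam A = leb (A `&` @unit_itv R).
Proof. by []. Qed.

Lemma integral_lebesgue01 (g : T -> \bar R) : (forall x, ~ unit_itv x -> g x = 0%E) ->
  (\int[leb]_x g x = \int[lam]_x g x)%E.
Proof.
move=> g0; have -> : g = g \_ (@unit_itv R).
  apply/funext => x; rewrite patchE; case: ifPn => //.
  by move=> /negP xu; apply: g0 => xi; apply: xu; rewrite inE.
rewrite -!integral_mkcond; apply: eq_measure_integral => A mA Au.
have E : leb (A `&` @unit_itv R) = leb A by rewrite setIidl.
exact: (esym E).
Qed.

Lemma product_lebesgue01 (A : set (T * T)) : measurable A ->
  A `<=` @unit_itv R `*` @unit_itv R -> (leb \x leb)%E A = (lam \x lam)%E A.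
Proof.
move=> mA Au; rewrite /product_measure1 /=.
have sect x : xsection A x `<=` @unit_itv R.
  by move=> y; rewrite /xsection /= inE => /Au[].
transitivity (\int[leb]_x lam (xsection A x))%E.
  apply: eq_integral => x _ /=.
  have E : leb (xsection A x `&` @unit_itv R) = leb (xsection A x) by rewrite setIidl.
  exact: (esym E).
apply: integral_lebesgue01 => x xu /=.
rewrite (_ : xsection A x = set0) ?measure0 //.
by apply/seteqP; split => // y; rewrite /xsection /= inE => /Au[].
Qed.

Definition half_open : set T := `]0%R, 1%R]%classic.

Lemma measurable_half_open : measurable half_open.
Proof. exact: measurable_itv. Qed.

Lemma mean_indic (A : set T) : measurable A -> mean lam \1_A = fine (leb (A `&` @unit_itv R)).
Proof.
move=> mA; rewrite /Rintegral integral_indic // setIT.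
by rewrite -lebesgue01E.
Qed.

Lemma mean_half_open : mean lam \1_half_open = 1.
Proof.
rewrite mean_indic; last exact: measurable_half_open.
rewrite setIidl; last by move=> x; rewrite /half_open /unit_itv /= !in_itv /= => /andP[/ltW -> ->].
by rewrite /half_open lebesgue_measure_itv /= lte_fin ltr01 oppr0 adde0.
Qed.

(** Composing with this retraction makes kernels and rearrangements total
  functions on the line, without a change on the unit interval. *)
Definition clamp (x : T) : T := Num.max 0 (Num.min 1 x).

Lemma clamp_unit x : unit_itv (clamp x).
Proof.
by rewrite /unit_itv /= in_itv /= /clamp le_max lexx /= ge_max ler01 ge_min lexx.
Qed.

Lemma clampK x : unit_itv x -> clamp x = x.
Proof.
by rewrite /unit_itv /= in_itv /= => /andP[x0 x1]; rewrite /clamp min_r // max_r.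
Qed.

Lemma measurable_clamp : measurable_fun setT clamp.
Proof.
apply: measurable_funTS.
apply: measurable_maxr; first exact: measurable_cst.
by apply: measurable_minr; [exact: measurable_cst|exact: measurable_id].
Qed.

End UnitInterval.
Section Cells.
Variables (R : realType) (n : nat).
Hypothesis n0 : (0 < n)%N.
Local Notation T := (measurableTypeR R).
Local Notation lam := (@lebesgue01 R).
Local Notation leb := (@lebesgue_measure R).
Let nn : 0 < n%:R :> R. Proof. by rewrite ltr0n. Qed.

Definition cell (i : 'I_n) : set T := `]i%:R / n%:R, i.+1%:R / n%:R]%classic.

Lemma cellP i (x : T) : cell i x <-> i%:R / n%:R < x <= i.+1%:R / n%:R.
Proof. by rewrite /cell /= in_itv. Qed.

Lemma cell_inj i j x : cell i x -> cell j x -> i = j.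
Proof.
move=> /cellP/andP[i1 i2] /cellP/andP[j1 j2]; apply/val_inj => /=.
have := lt_le_trans i1 j2; have := lt_le_trans j1 i2.
rewrite !ltr_pM2r ?invr_gt0 // !ltr_nat; lia.
Qed.

Lemma cell_exists (x : T) : half_open x -> exists i, cell i x.
Proof.
rewrite /half_open /= in_itv /= => /andP[x0 x1].
have ex : exists k, x <= k%:R / n%:R by exists n; rewrite divff ?gt_eqF.
case: (ex_minnP ex) => -[|k] xk kmin; first by move: xk; rewrite mul0r leNgt x0.
have kn : (k < n)%N by apply: kmin; rewrite divff ?gt_eqF.
exists (Ordinal kn); apply/cellP; rewrite xk andbT ltNge; apply/negP => /kmin.
by rewrite ltnn.
Qed.

(** The null set of points outside ]0, 1] is sent to the first cell, so that the
  fibres of [idx] partition the whole line. *)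
Definition idx (x : T) : 'I_n := odflt (Ordinal n0) [pick i | x \in cell i].

Lemma idx_cell i x : cell i x -> idx x = i.
Proof.
move=> xi; rewrite /idx; case: pickP => [j|/(_ i)] /=; last by rewrite mem_set.
by rewrite inE => xj; exact: cell_inj xj xi.
Qed.

Lemma idx_half_open x i : half_open x -> (idx x = i) <-> cell i x.
Proof.
move=> /cell_exists[j xj]; split=> [<-|]; last exact: idx_cell.
by rewrite (idx_cell xj).
Qed.

Lemma measurable_idx i : measurable (idx @^-1` [set i]).
Proof.
have mc j : measurable (cell j) by exact: measurable_itv.
have mU : measurable (\big[setU/set0]_(j < n) cell j) by exact: bigsetU_measurable.
have inU x : (\big[setU/set0]_(j < n) cell j) x <-> exists j, cell j x.
  rewrite -bigcup_seq; split=> [[j _ xj]|[j xj]]; first by exists j.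
  by exists j => //=; rewrite mem_index_enum.
rewrite (_ : idx @^-1` [set i] = cell i `|`
    (if i == Ordinal n0 then ~` \big[setU/set0]_(j < n) cell j else set0)).
  apply: measurableU => //; case: ifP => // _; exact: measurableC.
apply/seteqP; split => x /=.
  have [[j xj]|nx] := pselect (exists j, cell j x).
    by rewrite (idx_cell xj) => <-; left.
  move=> E; right; rewrite -E /idx; case: pickP => [j|_] /=.
    by rewrite inE => xj; case: nx; exists j.
  by rewrite ?eqxx => /inU.
case; first exact: idx_cell.
case: ifP => // /eqP -> nx; rewrite /idx; case: pickP => [j|] //=.
by rewrite inE => xj; case: nx; apply/inU; exists j.
Qed.

Definition ind i : T -> R := \1_(idx @^-1` [set i]).

Lemma bm_ind i : bounded_meas (ind i).
Proof. by apply: bm_indic; exact: measurable_idx. Qed.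

Lemma indE i x : ind i x = (idx x == i)%:R.
Proof. by rewrite /ind indicE; congr (nat_of_bool _)%:R; apply/idP/eqP; rewrite inE. Qed.

Lemma mean_ind i : mean lam (ind i) = n%:R^-1.
Proof.
rewrite -(mean_full (@measurable_half_open R) (mean_half_open R) (bm_ind i)).
rewrite (@eq_mean _ _ _ lam _ \1_(cell i)); last first.
  move=> x; rewrite indE !indicE -natrM mulnb; congr (nat_of_bool _)%:R.
  apply/andP/idP; rewrite !inE.
    by move=> [/eqP E xh]; apply/(idx_half_open _ xh).
  move=> xi; split; first by rewrite (idx_cell xi).
  move/cellP: xi => /andP[x0 x1]; rewrite /half_open /= in_itv /=.
  rewrite (le_lt_trans _ x0) ?divr_ge0 // (le_trans x1) // ler_pdivrMr // mul1r.
  by rewrite ler_nat.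
rewrite mean_indic; last exact: measurable_itv.
rewrite setIidl; last first.
  move=> x /cellP /andP[x0 x1]; rewrite /unit_itv /= in_itv /=.
  rewrite ltW ?(le_lt_trans _ x0) ?divr_ge0 // (le_trans x1) // ler_pdivrMr // mul1r.
  by rewrite ler_nat.
have lt : i%:R / n%:R < i.+1%:R / n%:R :> R.
  by rewrite ltr_pM2r ?invr_gt0 // ltr_nat.
rewrite /cell lebesgue_measure_itv /= lte_fin lt /= -mulrBl -natrB //.
by rewrite subSnn mul1r.
Qed.

Lemma comp_idxE (f : 'I_n -> R) x : f (idx x) = \sum_i f i * ind i x.
Proof.
rewrite (bigD1 (idx x)) //= indE eqxx mulr1 big1 ?addr0 // => i /negPf ne.
by rewrite indE eq_sym ne mulr0.
Qed.

Lemma bm_idx (f : 'I_n -> R) : bounded_meas (fun x => f (idx x)).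
Proof.
under eq_fun do rewrite comp_idxE.
by apply: bm_sum => i; apply: bmZ; exact: bm_ind.
Qed.

Lemma mean_idx (f : 'I_n -> R) : mean lam (fun x => f (idx x)) = n%:R^-1 * \sum_i f i.
Proof.
under eq_Rintegral do rewrite comp_idxE.
rewrite mean_sum; last by move=> i; apply: bmZ; exact: bm_ind.
rewrite mulr_sumr; apply: eq_bigr => i _.
by rewrite meanZ ?mean_ind 1?mulrC //; exact: bm_ind.
Qed.

Lemma weightfun_idx A (f : 'I_n -> R) : (forall i, 0 <= f i <= A) ->
  weightfun A (fun x => f (idx x)).
Proof. by move=> fA; split => //; have [] := bm_idx f. Qed.

Definition step_kernel (X : 'M[R]_n) (x y : T) : R := X (idx x) (idx y).

Lemma bm_step_kernel X : bounded_meas (fun z : T * T => step_kernel X z.1 z.2).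
Proof.
rewrite (_ : (fun z : T * T => _) = fun z => \sum_i \sum_j X i j * (ind i z.1 * ind j z.2)).
  apply: bm_sum => i; apply: bm_sum => j; apply: bmZ; apply: bmM.
    exact: (bm_comp measurable_fst (bm_ind i)).
  exact: (bm_comp measurable_snd (bm_ind j)).
apply/funext => z; rewrite /step_kernel (comp_idxE (fun i => X i (idx z.2))).
apply: eq_bigr => i _; rewrite (comp_idxE (X i)) mulr_suml.
by apply: eq_bigr => j _; ring.
Qed.

Definition cell_mean (a : T -> R) (i : 'I_n) : R :=
  n%:R * mean lam (fun x => ind i x * a x).

Lemma cell_mean_weight A a i : weightfun A a -> 0 <= cell_mean a i <= A.
Proof.
move=> wa; have ba := weightfun_bm wa; have bi := bm_ind i.
have [_ aA] := wa.
have i0 x : 0 <= ind i x by rewrite indE.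
rewrite mulr_ge0 ?(ltW nn) //=; last first.
  by apply: Rintegral_ge0 => x _; rewrite mulr_ge0 //; case/andP: (aA x).
rewrite /cell_mean mulrC -ler_pdivlMr // -(mean_ind i) -meanZ //.
apply: le_mean => [||x]; [exact: bmM|exact: bmZ|].
by rewrite mulrC ler_wpM2r //; case/andP: (aA x).
Qed.

Lemma form_step_kernel X (a b : T -> R) : bounded_meas a -> bounded_meas b ->
  cut_form (step_kernel X) a b =
  n%:R ^- 2 * \sum_i \sum_j cell_mean a i * X i j * cell_mean b j.
Proof.
move=> ba bb; have bia i := bmM (bm_ind i) ba; have bib i := bmM (bm_ind i) bb.
rewrite cut_formE1 //; last exact: bm_step_kernel.
have inner x : mean lam (fun y => step_kernel X x y * b y) =
    \sum_i (\sum_j X i j * mean lam (fun y => ind j y * b y)) * ind i x.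
  rewrite -comp_idxE.
  rewrite (@eq_mean _ _ _ lam _ (fun y => \sum_j X (idx x) j * (ind j y * b y))).
    rewrite mean_sum; last by move=> j; exact: bmZ.
    by apply: eq_bigr => j _; rewrite meanZ.
  move=> y; rewrite /step_kernel (comp_idxE (X (idx x))) mulr_suml.
  by apply: eq_bigr => j _; rewrite mulrA.
rewrite (@eq_mean _ _ _ lam _ (fun x => \sum_i
   (\sum_j X i j * mean lam (fun y => ind j y * b y)) * (ind i x * a x))); last first.
  by move=> x; rewrite inner mulr_suml; apply: eq_bigr => i _; rewrite mulrA.
rewrite mean_sum; last by move=> i; exact: bmZ.
rewrite mulr_sumr; apply: eq_bigr => i _; rewrite meanZ //.
rewrite mulr_suml mulr_sumr; apply: eq_bigr => j _; rewrite /cell_mean.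
by field; rewrite gt_eqF.
Qed.

Lemma cell_mean_idx (f : 'I_n -> R) i : cell_mean (fun x => f (idx x)) i = f i.
Proof.
rewrite /cell_mean (@eq_mean _ _ _ lam _ (fun x => f i * ind i x)); last first.
  move=> x; rewrite indE; case: eqP => [->|_]; first by rewrite mul1r mulr1.
  by rewrite mul0r mulr0.
by rewrite (meanZ lam _ (bm_ind i)) mean_ind mulrCA divff ?mulr1 // gt_eqF.
Qed.

Section Averages.
Variables (C : R) (K : T -> T -> R).
Hypotheses (mK : measurable_fun setT (fun z : T * T => K z.1 z.2))
  (KC : forall x y, 0 <= K x y <= C) (sK : forall x y, K x y = K y x).
Let bK : bounded_meas (fun z : T * T => K z.1 z.2).
Proof. by split=> //; exists C => z; have /andP[h ?] := KC z.1 z.2; rewrite ger0_norm. Qed.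

Definition cell_average : 'M[R]_n := \matrix_(i, j) (n%:R ^+ 2 * cut_form K (ind i) (ind j)).

Lemma cell_average_sym i j : cell_average i j = cell_average j i.
Proof.
rewrite !mxE; apply: (congr1 (fun u => _ * u)).
rewrite (cut_formE1 _ bK (bm_ind j)) (cut_formE2 bK (bm_ind j) (bm_ind i)).
apply: eq_mean => x; congr (_ * _).
by apply: eq_mean => y; rewrite sK.
Qed.

Lemma cell_average_bounds i j : 0 <= cell_average i j <= C.
Proof.
have i0 l x : 0 <= ind l x by rewrite indE.
have b1 := bm_cut_form bK (bm_ind i) (bm_ind j).
have K0 x y : 0 <= K x y by case/andP: (KC x y).
have KC' x y : K x y <= C by case/andP: (KC x y).
rewrite mxE mulr_ge0 ?sqr_ge0 //=; last first.
  apply: Rintegral_ge0 => x _; apply: Rintegral_ge0 => y _.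
  by rewrite !mulr_ge0.
rewrite mulrC -ler_pdivlMr ?exprn_gt0 //.
apply: (@le_trans _ _ (mean lam (fun x => C / n%:R * ind i x))); last first.
  by rewrite (meanZ lam _ (bm_ind i)) mean_ind expr2 invfM mulrA.
apply: le_mean => [||x].
- exact: (bm_mean1 lam lam b1).
- exact: bmZ (bm_ind i).
rewrite -(mean_ind j) mulrAC -meanZ; last exact: bm_ind.
apply: le_mean => [||y]; [exact: (bm_section1 b1 x)|exact: bmZ (bm_ind j)|].
by rewrite mulrA ler_wpM2r // ler_wpM2r.
Qed.

Lemma form_cell_average (f g : 'I_n -> R) :
  cut_form K (fun x => f (idx x)) (fun x => g (idx x)) =
  n%:R ^- 2 * \sum_i \sum_j f i * cell_average i j * g j.
Proof.
have bj j := bm_ind j.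
rewrite (cut_formE1 _ bK (bm_idx g)).
rewrite (@eq_mean _ _ _ lam _ (fun x => \sum_i f i *
   (\sum_j g j * (mean lam (fun y => K x y * ind j y) * ind i x)))).
  have b1 i j : bounded_meas (fun x => mean lam (fun y => K x y * ind j y) * ind i x).
    apply: bmM (bm_ind i).
    have b2 : bounded_meas (fun z : T * T => K z.1 z.2 * ind j z.2).
      exact: bmM bK (bm_comp measurable_snd (bm_ind j)).
    exact: (bm_mean1 lam lam b2).
  rewrite mean_sum; last by move=> i; apply/bmZ/bm_sum => j; exact: bmZ.
  rewrite mulr_sumr; apply: eq_bigr => i _; rewrite meanZ; last first.
    by apply: bm_sum => j; exact: bmZ.
  rewrite mean_sum; last by move=> j; exact: bmZ.
  rewrite !mulr_sumr; apply: eq_bigr => j _; rewrite meanZ // -(cut_formE1 _ bK) // mxE.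
  by field; rewrite gt_eqF.
move=> x.
have -> : mean lam (fun y => K x y * g (idx y)) =
    \sum_j g j * mean lam (fun y => K x y * ind j y).
  have b2 j : bounded_meas (fun y => K x y * ind j y).
    exact: bmM (bm_section1 bK x) (bm_ind j).
  rewrite (@eq_mean _ _ _ lam _ (fun y => \sum_j g j * (K x y * ind j y))).
    rewrite mean_sum; last by move=> j; exact: bmZ.
    by apply: eq_bigr => j _; rewrite meanZ.
  by move=> y; rewrite comp_idxE mulr_sumr; apply: eq_bigr => j _; ring.
rewrite comp_idxE mulr_sumr; apply: eq_bigr => i _.
by rewrite mulr_suml mulr_sumr; apply: eq_bigr => j _; ring.
Qed.

(** Averaging is self-adjoint, so it moves to the two test functions, and the
  form of a step kernel is the same at a, b and at their cell means.  Hence both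
  comparisons with the step kernel X only involve K itself. *)
Lemma form_average_close (X : 'M[R]_n) (d : R) :
  (forall A a b, weightfun A a -> weightfun A b ->
     `|cut_form (step_kernel X) a b - cut_form K a b| <= A ^+ 2 * d) ->
  forall A a b, weightfun A a -> weightfun A b ->
     `|cut_form (step_kernel cell_average) a b - cut_form K a b| <= A ^+ 2 * (2 * d).
Proof.
move=> close A a b wa wb; have ba := weightfun_bm wa; have bb := weightfun_bm wb.
have wma := weightfun_idx (fun i => cell_mean_weight i wa).
have wmb := weightfun_idx (fun i => cell_mean_weight i wb).
have E1 : cut_form (step_kernel cell_average) a b =
    cut_form K (fun x => cell_mean a (idx x)) (fun x => cell_mean b (idx x)).
  by rewrite form_step_kernel // form_cell_average.
have E2 : cut_form (step_kernel X) a b =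
    cut_form (step_kernel X) (fun x => cell_mean a (idx x)) (fun x => cell_mean b (idx x)).
  rewrite (form_step_kernel X ba bb) (form_step_kernel X (bm_idx _) (bm_idx _)).
  apply: (congr1 (fun u => _ * u)); apply: eq_bigr => i _; apply: eq_bigr => j _.
  by rewrite !cell_mean_idx.
rewrite E1 mulrCA mulr_natl mulr2n.
apply: (le_trans (ler_distD (cut_form (step_kernel X) a b) _ _)); apply: lerD.
  by rewrite E2 distrC; exact: close.
exact: close.
Qed.

End Averages.
End Cells.
(** * The cut norm and rearrangements *)

Section CutNorm.
Variable R : realType.
Local Notation T := (measurableTypeR R).
Local Notation lam := (@lebesgue01 R).
Local Notation leb := (@lebesgue_measure R).

Lemma cut_form_half_open (D : T -> T -> R) (S S' : set T) :
  bounded_meas (fun z : T * T => D z.1 z.2) -> measurable S -> measurable S' ->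
  cut_form D \1_S \1_S' = mean (lam \x lam)%E
    (fun z => D z.1 z.2 * \1_((S `&` @half_open R) `*` (S' `&` @half_open R)) z).
Proof.
move=> bD mS mS'; have mh := @measurable_half_open R; have h1 := mean_half_open R.
have bS := bm_indic R mS; have bS' := bm_indic R mS'; have bh := bm_indic R mh.
have b1 : bounded_meas (fun z : T * T => D z.1 z.2 * \1_S' z.2).
  exact: bmM bD (bm_comp measurable_snd bS').
have b2 := bmM b1 (bm_comp measurable_snd bh).
rewrite (cut_formE1 _ bD bS').
rewrite -(mean_full mh h1 (bmM (bm_mean1 lam lam b1) bS)).
rewrite (mean_fubini1 lam lam (bmM bD (bm_indic R _))); last first.
  by apply: measurableX; exact: measurableI.
apply: eq_mean => x /=.
rewrite -(mean_full mh h1 (bm_section1 b1 x)) /= -mulrA mulrC.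
rewrite -(meanZ lam _ (bm_section1 b2 x)); apply: eq_mean => y /=.
have -> : \1_((S `&` @half_open R) `*` (S' `&` @half_open R)) (x, y) =
    (\1_S x * \1_(@half_open R) x) * (\1_S' y * \1_(@half_open R) y) :> R.
  rewrite !indicE -!natrM !mulnb; congr (nat_of_bool _)%:R.
  by rewrite in_setX !in_setI.
by ring.
Qed.

(** The difference D1 - D2 has to agree with W only up to a null set: this leaves
  out the point 0, which belongs to no cell. *)
Lemma cut_norm_form (W D1 D2 : T -> T -> R) (d : R) (S S' : set T) :
  bounded_meas (fun z : T * T => D1 z.1 z.2) ->
  bounded_meas (fun z : T * T => D2 z.1 z.2) ->
  (forall x y, half_open x -> half_open y -> W x y = D1 x y - D2 x y) ->
  (cut_norm W < d%:E)%E -> measurable S -> measurable S' ->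
  `|cut_form D1 \1_S \1_S' - cut_form D2 \1_S \1_S'| <= d.
Proof.
move=> b1 b2 WE cutW mS mS'.
have bS := bm_indic R mS; have bS' := bm_indic R mS'.
rewrite -cut_formB // -lee_fin; apply: (le_trans _ (ltW cutW)).
have mh := @measurable_half_open R.
have hu : @half_open R `<=` @unit_itv R.
  by move=> x; rewrite /half_open /unit_itv /= !in_itv /= => /andP[/ltW -> ->].
set A := S `&` @half_open R; set B := S' `&` @half_open R.
have mA : measurable A by exact: measurableI.
have mB : measurable B by exact: measurableI.
have mAB : measurable (A `*` B) by exact: measurableX.
apply: ereal_sup_ubound; exists A, B; split=> //.
- by move=> x [_ /hu].
- by move=> x [_ /hu].
have bD : bounded_meas (fun z : T * T => D1 z.1 z.2 - D2 z.1 z.2) by exact: bmB.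
rewrite (cut_form_half_open (D := fun x y => D1 x y - D2 x y)) //.
rewrite -abse_EFin.
rewrite (mean_EFin (lam \x lam)%E (bmM bD (bm_indic R mAB))).
apply: (congr1 abse).
transitivity (\int[(leb \x leb)%E]_(z in A `*` B) (D1 z.1 z.2 - D2 z.1 z.2)%:E)%E; last first.
  apply: eq_integral => -[x y]; rewrite inE => -[[_ xh] [_ yh]].
  by rewrite -WE.
transitivity (\int[(lam \x lam)%E]_(z in A `*` B) (D1 z.1 z.2 - D2 z.1 z.2)%:E)%E; last first.
  apply: eq_measure_integral => E mE EAB; apply/esym/product_lebesgue01 => //.
  by move=> z /EAB [[_ /hu ?] [_ /hu ?]].
rewrite [RHS]integral_mkcond; apply: eq_integral => z _.
by rewrite patchE indicE; case: ifP => _; rewrite ?mulr1 ?mulr0.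
Qed.

End CutNorm.

Section Rearrangement.
Variable R : realType.
Local Notation T := (measurableTypeR R).
Local Notation lam := (@lebesgue01 R).
Local Notation leb := (@lebesgue_measure R).
Variables (C : R) (kappa : R -> R -> R).
Hypotheses (hk : is_kernel kappa)
  (kC : forall x y, unit_itv x -> unit_itv y -> kappa x y <= C).

Definition clamped (x y : T) : R := kappa (clamp x) (clamp y).

Lemma clamped_bounds x y : 0 <= clamped x y <= C.
Proof.
have [_ _ k0] := hk; have ux := clamp_unit x; have uy := clamp_unit y.
by rewrite k0 //= kC.
Qed.

Lemma clamped_sym x y : clamped x y = clamped y x.
Proof. by have [_ ks _] := hk; apply: ks; exact: clamp_unit. Qed.

Lemma measurable_clamped : measurable_fun setT (fun z : T * T => clamped z.1 z.2).
Proof.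
have [mk _ _] := hk.
have mu := @measurable_unit_itv R.
have mg : measurable_fun setT (fun z : T * T => (clamp z.1, clamp z.2)).
  apply/measurable_fun_pairP; split.
    exact: (measurableT_comp (@measurable_clamp R) measurable_fst).
  exact: (measurableT_comp (@measurable_clamp R) measurable_snd).
have sub : [set (clamp z.1, clamp z.2) | z in [set: T * T]] `<=` @unit_itv R `*` @unit_itv R.
  by move=> _ [z _ <-]; split; exact: clamp_unit.
exact: (measurable_comp (measurableX mu mu) sub mk mg).
Qed.

Lemma bm_clamped : bounded_meas (fun z : T * T => clamped z.1 z.2).
Proof.
split; first exact: measurable_clamped.
by exists C => z; have /andP[h ?] := clamped_bounds z.1 z.2; rewrite ger0_norm.
Qed.

Lemma kernel_density_clamped k (F : sgraph 'I_k) :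
  kernel_density F kappa = (cube_density F clamped)%:E.
Proof.
have bH : bounded_meas (fun x : k.-tuple T => \prod_(i < k)
    \prod_(j < k | (i < j)%N && adj F i j) clamped (tnth x i) (tnth x j)).
  apply: bm_prod => i; apply: bm_prod => j.
  have mij : measurable_fun setT (fun x : k.-tuple T => (tnth x i, tnth x j)).
    by apply/measurable_fun_pairP; split; exact: measurable_coord.
  exact: (bm_comp mij bm_clamped).
have mc := @measurable_cube R k.
rewrite /cube_density -(mean_full mc (mean_cube R k) bH).
rewrite (mean_EFin (lebesgue_cube R k) (bmM bH (bm_indic R mc))).
rewrite /kernel_density integral_mkcond; apply: eq_integral => x _.
rewrite patchE indicE; case: ifPn => [|_]; last by rewrite mulr0.
rewrite inE mulr1 => xc; congr (_%:E).
apply: eq_bigr => i _; apply: eq_bigr => j _.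
by rewrite /clamped !clampK //; exact: xc.
Qed.

Variable tau : R -> R.
Hypothesis htau : mpreserving_bij01 tau.

Definition clamped_map (x : T) : T := tau (clamp x).

Lemma measurable_clamped_map : measurable_fun setT clamped_map.
Proof.
have [_ mt _] := htau.
have sub : [set clamp x | x in [set: T]] `<=` @unit_itv R.
  by move=> _ [z _ <-]; exact: clamp_unit.
exact: (measurable_comp (@measurable_unit_itv R) sub mt (@measurable_clamp R)).
Qed.

Lemma clamped_map_preserves (A : set T) : measurable A ->
  pushforward lam clamped_map A = lam A.
Proof.
move=> mA; have [[ft _ _] _ pt] := htau.
have mu := @measurable_unit_itv R.
rewrite lebesgue01E -(pt _ (measurableI _ _ mA mu)); last by move=> x [].
rewrite /pushforward lebesgue01E; congr (leb _); apply/seteqP; split => x /=.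
  move=> [Ax ux]; split => //; move: Ax; rewrite /clamped_map clampK // => Ax.
  by split => //; exact: ft.
by move=> [ux [Ax _]]; split => //; rewrite /clamped_map clampK.
Qed.

Lemma mean_clamped_map (f : T -> R) : bounded_meas f ->
  mean lam (fun x => f (clamped_map x)) = mean lam f.
Proof.
move=> bf; rewrite -(mean_pushforward lam measurable_clamped_map bf); congr fine.
apply: eq_measure_integral; first exact: measurable_clamped_map.
by move=> mt A mA _; exact: clamped_map_preserves.
Qed.

Definition rearranged (x y : T) : R := clamped (clamped_map x) (clamped_map y).

Lemma measurable_rearranged : measurable_fun setT (fun z : T * T => rearranged z.1 z.2).
Proof.
have mt := measurable_clamped_map.
have m2 : measurable_fun setT (fun z : T * T => (clamped_map z.1, clamped_map z.2)).
  apply/measurable_fun_pairP; split.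
    exact: (measurableT_comp mt measurable_fst).
  exact: (measurableT_comp mt measurable_snd).
exact: (measurableT_comp measurable_clamped m2).
Qed.

Lemma rearranged_bounds x y : 0 <= rearranged x y <= C.
Proof. exact: clamped_bounds. Qed.

Lemma rearranged_sym x y : rearranged x y = rearranged y x.
Proof. exact: clamped_sym. Qed.

(** Change of variables in each coordinate of the cube. *)
Lemma cube_density_rearranged k (F : sgraph 'I_k) :
  cube_density F rearranged = cube_density F clamped.
Proof.
have bH : bounded_meas (fun x : k.-tuple T => \prod_(i < k)
    \prod_(j < k | (i < j)%N && adj F i j) clamped (tnth x i) (tnth x j)).
  apply: bm_prod => i; apply: bm_prod => j.
  have mij : measurable_fun setT (fun x : k.-tuple T => (tnth x i, tnth x j)).
    by apply/measurable_fun_pairP; split; exact: measurable_coord.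
  exact: (bm_comp mij bm_clamped).
rewrite /cube_density -[RHS](mean_cube_map measurable_clamped_map mean_clamped_map bH).
by apply: eq_mean => x; do 2 (apply: eq_bigr => ? _); rewrite !tnth_map.
Qed.

End Rearrangement.
(** * Passing to matrices, and the limit *)

Section Approximation.
Variable R : realType.
Local Notation T := (measurableTypeR R).

Lemma tpE (p : R) k (F : sgraph 'I_k) n (G : sgraph 'I_n) :
  tp p F G = hom_density F (p^-1 *: adjacency R G).
Proof. by rewrite /tp !card_ord tp_hom_density. Qed.

Lemma graph_kernel_step (p : R) n (n0 : (0 < n)%N) (G : sgraph 'I_n) (x y : T) :
  half_open x -> half_open y ->
  graph_kernel p G x y = step_kernel n0 (p^-1 *: adjacency R G) x y.
Proof.
move=> /(cell_exists n0)[i xi] /(cell_exists n0)[j yj].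
rewrite /step_kernel (idx_cell n0 xi) (idx_cell n0 yj) !mxE /graph_kernel.
case: ifPn => [/existsP[i' /existsP[j' /and3P[ij xi' yj']]]|nex].
  have -> : i = i' by apply: (cell_inj n0 xi); apply/cellP.
  have -> : j = j' by apply: (cell_inj n0 yj); apply/cellP.
  by rewrite ij mulr1.
case: (boolP (adj G i j)) => ij; last by rewrite mulr0.
case/negP: nex; apply/existsP; exists i; apply/existsP; exists j.
by rewrite ij; move/cellP: xi => ->; move/cellP: yj => ->.
Qed.

Lemma d_cut_lt (k1 k2 : R -> R -> R) (d : R) : (d_cut k1 k2 < d%:E)%E ->
  exists2 tau, mpreserving_bij01 tau &
    (cut_norm (fun x y => k1 x y - k2 (tau x) (tau y))%R < d%:E)%E.
Proof. by move=> /ereal_inf_lt[_ [tau ht <-] lt]; exists tau. Qed.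

(** The matrix K averages the rearranged kernel over the cells.  The factor 2 in
  the last bound comes from comparing the average with the step kernel of G, and
  that with the rearranged kernel. *)
Lemma matrix_approximation (C : R) (kappa : R -> R -> R) (p d : R) n (G : sgraph 'I_n) :
  1 <= C -> is_kernel kappa ->
  (forall x y, unit_itv x -> unit_itv y -> kappa x y <= C) ->
  (0 < n)%N -> (d_cut (graph_kernel p G) kappa < d%:E)%E ->
  exists K : 'M[R]_n,
  [/\ (forall i j, 0 <= K i j <= C), (forall i j, K i j = K j i),
      (forall f g : 'I_n -> R, (forall i, 0 <= f i <= 1) -> (forall i, 0 <= g i <= 1) ->
        `|\sum_i \sum_j f i * (p^-1 *: adjacency R G - K) i j * g j| <= n%:R ^+ 2 * d) &
      forall k (F : sgraph 'I_k), `|hom_density F K - cube_density F (clamped kappa)| <=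
        #|edges F|%:R * ((C ^+ #|edges F|) ^+ 2 * (2 * d))].
Proof.
move=> C1 hk kC n0 /d_cut_lt[tau ht cut].
pose Kt := rearranged kappa tau; pose W := p^-1 *: adjacency R G.
have mKt : measurable_fun setT (fun z : T * T => Kt z.1 z.2).
  exact: measurable_rearranged.
have KtC x y : 0 <= Kt x y <= C by exact: rearranged_bounds.
have sKt x y : Kt x y = Kt y x by exact: rearranged_sym.
have bKt : bounded_meas (fun z : T * T => Kt z.1 z.2).
  by split=> //; exists C => z; have /andP[h ?] := KtC z.1 z.2; rewrite ger0_norm.
have bW := bm_step_kernel n0 W.
have close A a b : weightfun A a -> weightfun A b ->
    `|cut_form (step_kernel n0 W) a b - cut_form Kt a b| <= A ^+ 2 * d.
  apply: form_weight_norm => // S S' mS mS'.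
  apply: (cut_norm_form bW bKt _ cut mS mS') => x y hx hy.
  rewrite (graph_kernel_step p n0 G hx hy); congr (_ - _).
  have hu (z : T) : half_open z -> unit_itv z.
    by rewrite /half_open /unit_itv /= !in_itv /= => /andP[/ltW -> ->].
  rewrite /Kt /rearranged /clamped /clamped_map !clampK //; try exact: hu.
    by have [[ft _ _] _ _] := ht; apply: ft; exact: hu.
  by have [[ft _ _] _ _] := ht; apply: ft; exact: hu.
have nn : n%:R != 0 :> R by rewrite pnatr_eq0 -lt0n.
exists (cell_average n0 Kt); split.
- exact: cell_average_bounds.
- exact: (cell_average_sym n0 mKt KtC sKt).
- move=> f g f1 g1.
  have := close 1 _ _ (weightfun_idx n0 f1) (weightfun_idx n0 g1).
  rewrite form_step_kernel; [|exact: bm_idx|exact: bm_idx].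
  rewrite (form_cell_average n0 mKt KtC) expr1n mul1r -mulrBr normrM.
  rewrite ger0_norm ?invr_ge0 ?exprn_ge0 // mulrC ler_pdivrMr ?exprn_gt0 ?ltr0n //.
  rewrite mulrC; apply: le_trans; rewrite le_eqVlt; apply/orP; left; apply/eqP.
  congr (`|_|); rewrite -sumrB; apply: eq_bigr => i _; rewrite -sumrB.
  by apply: eq_bigr => j _; rewrite !cell_mean_idx !mxE; ring.
move=> k F; rewrite -(cube_density_rearranged hk kC ht F).
have <- : cube_density F (step_kernel n0 (cell_average n0 Kt)) =
    hom_density F (cell_average n0 Kt).
  pose H (f : {ffun 'I_k -> 'I_n}) := weight (cell_average n0 Kt) F f.
  rewrite /hom_density -exprVn -(mean_cube_finite H (measurable_idx n0) (mean_idx n0)).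
  apply: eq_mean => x; apply: eq_bigr => i _; apply: eq_bigr => j _.
  by rewrite /step_kernel !ffunE.
apply: (counting_lemma C1) => //.
- by have [] := bm_step_kernel n0 (cell_average n0 Kt).
- by move=> x y; exact: cell_average_bounds.
exact: (form_average_close mKt KtC close).
Qed.

(** The three density bounds are read off from the star with 4 leaves, from the
  cycle as a subdivision of a double edge, and from the parallel edges. *)
Lemma close_pair_matrices (C : R) m (B0 B1 : R) (Bq : nat -> R) (d p : R) n
    (G : sgraph 'I_n) (K : 'M[R]_n) : (0 < n)%N -> 0 < p ->
  (forall i j, 0 <= K i j <= C) -> (forall i j, K i j = K j i) ->
  (forall f g : 'I_n -> R, (forall i, 0 <= f i <= 1) -> (forall i, 0 <= g i <= 1) ->
    `|\sum_i \sum_j f i * (p^-1 *: adjacency R G - K) i j * g j| <= n%:R ^+ 2 * d) ->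
  hom_density (star 4) (p^-1 *: adjacency R G) <= B0 ->
  hom_density (cycle_graph (2 * m.+3 - 2)) (p^-1 *: adjacency R G) <= B1 ->
  (forall q, n%:R ^- 2 * (\sum_i \sum_j
    (n%:R * ((n%:R^-1 *: (p^-1 *: adjacency R G)) ^+ m.+3) i j) ^+ q) <= Bq q) ->
  close_pair C m.+1 B0 B1 Bq d (n%:R^-1 *: (p^-1 *: adjacency R G)) (n%:R^-1 *: K).
Proof.
move=> n0 p0 KC sK cut star4 cyc theta; set W := p^-1 *: adjacency R G in cut star4 cyc theta *.
have nn : 0 < n%:R :> R by rewrite ltr0n.
have nz : n%:R != 0 :> R by rewrite gt_eqF.
have W0 i j : 0 <= W i j by rewrite !mxE mulr_ge0 ?invr_ge0 ?ler0n // ltW.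
have sW i j : W i j = W j i by rewrite !mxE adj_sym.
have ni : 0 <= n%:R^-1 :> R by rewrite invr_ge0 ltW.
split=> //.
- by move=> i j; rewrite mxE mulr_ge0.
- by move=> i j; rewrite mxE mulr_ge0 //; case/andP: (KC i j).
- by move=> i j; rewrite mxE mulrC ler_wpM2r //; case/andP: (KC i j).
- by apply/matrixP => i j; rewrite mxE [LHS]mxE [RHS]mxE sW.
- by apply/matrixP => i j; rewrite mxE [LHS]mxE [RHS]mxE sK.
- move: cyc; rewrite (hom_density_subdivision n0 W0 sW (cycle_double m)) density_double //.
  elim: m.+2 => [|j IH]; first by rewrite expr0 trmx1.
  rewrite [in LHS]exprSr -mulmxE trmx_mul IH mulmxE exprS; congr (_ * _).
  by apply/matrixP => i j'; rewrite mxE [LHS]mxE [RHS]mxE sW.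
- by move=> q; move: (theta q); rewrite mulrC ler_pdivrMr // exprn_gt0.
- move: star4; rewrite hom_density_star // mulrC ler_pdivrMr //.
  apply: le_trans; rewrite le_eqVlt; apply/orP; left; apply/eqP.
  by apply: eq_bigr => i _; congr (_ ^+ _); apply: eq_bigr => j _; rewrite mxE.
move=> f g f1 g1; have := cut f g f1 g1.
rewrite expr2 -mulrA -ler_pdivrMl // => /(le_trans _); apply.
rewrite -[X in X * _](ger0_norm ni) -normrM mulr_sumr.
rewrite le_eqVlt; apply/orP; left; apply/eqP; congr (`|_|).
apply: eq_bigr => i _; rewrite mulr_sumr; apply: eq_bigr => j _.
by rewrite !mxE; ring.
Qed.

End Approximation.

Unset Implicit Arguments.

Theorem theorem5p14 (R : realType) (C : R) (hC : 0 < C)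
  (l : nat) (hl : (3 <= l)%N)
  (p : nat -> R) (hp : forall n, 0 < p n)
  (N : set nat) (hN : infinite_set N)
  (G : forall n : nat, sgraph 'I_n)
  (hbounded : forall (k : nat) (F : sgraph 'I_k),
     is_tree F \/ in_subdiv_family l F \/
       sgraph_iso F (cycle_graph (2 * l - 2)%N) ->
     has_ubound [set tp (p n) F (G n) | n in N])
  (kappa : R -> R -> R) (hkappa : is_kernel kappa)
  (hkappaC : forall x y, unit_itv x -> unit_itv y -> kappa x y <= C)
  (hcut : d_cut (graph_kernel (p n) (G n)) kappa @[n --> within N \oo] --> 0%E)
  (k : nat) (F : sgraph 'I_k) (hF : in_subdiv_family l F) :
  (tp (p n) F (G n))%:E @[n --> within N \oo] --> kernel_density F kappa.
Proof.
case: l hl hbounded hF => [|[|[|m]]] // _ hbounded [M iso].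
(* the estimates need a bound that is at least 1 *)
pose D := C + 1.
have D1 : 1 <= D by rewrite lerDr ltW.
have kD x y : unit_itv x -> unit_itv y -> kappa x y <= D.
  by move=> ux uy; rewrite (le_trans (hkappaC x y ux uy)) // lerDl.
rewrite (kernel_density_clamped hkappa kD F).
pose W n : 'M[R]_n := (p n)^-1 *: adjacency R (G n).
have W0 n i j : 0 <= W n i j by rewrite !mxE mulr_ge0 ?invr_ge0 ?ler0n // ltW.
have sW n i j : W n i j = W n j i by rewrite !mxE adj_sym.
have bound k' (F' : sgraph 'I_k') : is_tree F' \/ in_subdiv_family m.+3 F' \/
      sgraph_iso F' (cycle_graph (2 * m.+3 - 2)%N) ->
    exists B, forall n, N n -> hom_density F' (W n) <= B.
  move=> /hbounded[B ubB]; exists B => n Nn; rewrite -tpE.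
  by apply: ubB; exists n.
have [B0 HB0] := bound _ _ (or_introl (star_tree 4)).
have [B1 HB1] : exists B, forall n, N n ->
    hom_density (cycle_graph (2 * m.+3 - 2)) (W n) <= B.
  apply: bound; right; right; exists id => //; exact: (Bijective (fun=> erefl) (fun=> erefl)).
have theta q : exists B, forall n, N n -> (0 < n)%N -> n%:R ^- 2 * (\sum_i \sum_j
    (n%:R * ((n%:R^-1 *: W n) ^+ m.+3) i j) ^+ q) <= B.
  have [F' isoF] := enum_sgraph (subdivision m.+3 (parallel_edges q)).
  have [|B HB] := bound _ F'; first by right; left; exists (parallel_edges q).
  exists B => n Nn n0; have := HB n Nn.
  by rewrite (hom_density_subdivision n0 (@W0 n) (@sW n) isoF) density_parallel.
have [Bq HBq] := choice theta.
have B1' : 0 <= `|B1| by [].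
have sd := small_density m.+1 B0 Bq D1 B1' (@mloopless M).
apply: cvg_EFin; first exact: nearW.
apply/cvgrPdist_le => e e0 /=.
have e2 : 0 < e / 2 by rewrite divr_gt0.
have [d0 d00 Hd] := sd _ e2.
set s := cube_density F (clamped kappa).
pose c := #|edges F|%:R * (D ^+ #|edges F|) ^+ 2 * 2.
have c0 : 0 <= c by rewrite mulr_ge0 // mulr_ge0 // sqr_ge0.
have c1 : 0 < c + 1 by rewrite ltr_wpDl.
pose d := Num.min d0 (e / 2 / (c + 1)).
have dpos : 0 < d by rewrite lt_min d00 divr_gt0.
have near_cut : \forall n \near within N \oo,
    (d_cut (graph_kernel (p n) (G n)) kappa < d%:E)%E.
  have lt_nbhs : nbhs (0%E : \bar R) (fun u => (u < d%:E)%E).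
    by apply: open_ereal_lt'; rewrite lte_fin.
  exact: (hcut _ lt_nbhs).
have near_N : \forall n \near within N \oo, N n by exact: near_withinT.
have near_pos : \forall n \near within N \oo, (0 < n)%N.
  by apply: cvg_within; exists 1%N.
near=> n.
have Nn : N n by near: n.
have n0 : (0 < n)%N by near: n.
have dc : (d_cut (graph_kernel (p n) (G n)) kappa < d%:E)%E by near: n.
have [K [KD sK cutK densK]] := matrix_approximation D1 hkappa kD n0 dc.
have cl : close_pair D m.+1 B0 `|B1| Bq d (n%:R^-1 *: W n) (n%:R^-1 *: K).
  apply: close_pair_matrices => //.
  - exact: HB0.
  - by apply: (le_trans (HB1 n Nn)); exact: ler_norm.
  - by move=> q; exact: HBq.
have dd0 : d <= d0 by rewrite ge_min lexx.
have K0 i j : 0 <= K i j by case/andP: (KD i j).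
have := Hd d n _ _ dd0 cl.
rewrite -(hom_density_subdivision n0 (@W0 n) (@sW n) iso).
rewrite -(hom_density_subdivision n0 K0 sK iso) => h1.
have h2 : `|hom_density F K - s| <= e / 2.
  apply: (le_trans (densK _ F)); rewrite mulrA mulrA -/c.
  apply: (@le_trans _ _ ((c + 1) * d)); first by rewrite ler_wpM2r ?(ltW dpos) // lerDl.
  by rewrite mulrC -ler_pdivlMr // ge_min lexx orbT.
rewrite tpE -/(W n) distrC (splitr e).
by apply: (le_trans (ler_distD (hom_density F K) _ _)); exact: lerD.
Unshelve. all: by end_near.
Qed.
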